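(* Let $M$ be a generic regular closed curve in $\mathbb{R}^2$. If $M$ has $2n$ inflexion points, then every branch of $\mathrm{SC}(M)$ is a closed curve and there exist exactly $n$ branches such that (i) the origin is the center of symmetry of each such branch, (ii) each such branch passes through the origin twice and each time the origin is an inflexion point of this branch.
   Context: A closed regular curve $M$ is the image of a $C^\infty$ immersion $f:S^1\to\mathbb{R}^2$. A parallel pair of $M$ is a pair of points $a,b\in M$, $a\neq b$, such that the tangent lines to $M$ at $a$ and $b$ are parallel. The secant caustic is $\mathrm{SC}(M)=\mathrm{cl}\{a-b : a,b \text{ is a parallel pair of } M\}$. A point of $M$ is an inflexion point if the signed curvature changes sign there; an undulation point is a point where the curvature vanishes without changing sign. An inflexion point $f(s_0)$ is non-degenerate if $\det(f'(s_0),f'''(s_0))\neq 0$. $M$ is parameterized in the same direction at $f(s_1)$ and $f(s_2)$ if $f'(s_1)=\alpha f'(s_2)$ with $\alpha>0$. $M$ is generic if: (i) $f$ is regular; (ii) $f$ has only non-degenerate inflexion points and no undulation points; (iii) $f$ has only transversal self-crossings; (iv) if $f(s_1),f(s_2)$ is a parallel pair then at least one of them is not an inflexion point; (v) if $f(s_1),f(s_2)$ with $s_1\neq s_2$ is a parallel pair and, for local arc length parameterizations near $s_1$ and $s_2$ chosen in the same direction, the signed curvatures at $f(s_1)$ and $f(s_2)$ are equal, then the derivatives of the curvatures with respect to arc length at these points are different. The (smooth) branches of $\mathrm{SC}(M)$ are the smooth parameterized curves obtained by restricting the map $(s,t)\mapsto f(s)-f(t)$ to the connected components of $\Sigma=\mathrm{cl}\{(s,t)\in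 S^1\times S^1: s\neq t,\ \det(f'(s),f'(t))=0\}$, which is a smooth $1$-dimensional submanifold; distinct components count as distinct branches. A point $c$ is a center of symmetry of a curve $C$ if $2c-a\in C$ for every $a\in C$. A point of a branch is an inflexion point if it is a regular point of the parameterized branch at which the curvature changes sign. *)

(* Defs.v *)
From mathcomp Require Import all_boot all_order all_algebra.
From mathcomp Require Import all_classical all_reals all_analysis.
Set Implicit Arguments.
Unset Strict Implicit.
Unset Printing Implicit Defensive.
Import Order.TTheory GRing.Theory Num.Theory.
Import numFieldNormedType.Exports.
Local Open Scope ring_scope.
Local Open Scope classical_set_scope.

(* The plane R^2 is the product R * R.  Its library norm is the sup norm, hence
   the separate Euclidean norm below. *)

Definition det2 (R : realType) (a b : R * R) : R := a.1 * b.2 - a.2 * b.1.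

Definition enorm (R : realType) (a : R * R) : R :=
  Num.sqrt (a.1 ^+ 2 + a.2 ^+ 2).

Definition smooth (R : realType) (V : normedModType R) (g : R -> V) : Prop :=
  forall (n : nat) (s : R), derivable (g^`(n)) s 1.

(* The signed curvature; meaningful where the velocity does not vanish. *)
Definition curvature (R : realType) (g : R -> R * R) (s : R) : R :=
  det2 (g^`() s) (g^`(2) s) / enorm (g^`() s) ^+ 3.

Definition changes_sign (R : realType) (h : R -> R) (s : R) : Prop :=
  ((\forall u \near s^'-, h u < 0) /\ (\forall u \near s^'+, 0 < h u)) \/
  ((\forall u \near s^'-, 0 < h u) /\ (\forall u \near s^'+, h u < 0)).

Definition inflexion (R : realType) (g : R -> R * R) (s : R) : Prop :=
  g^`() s <> 0 /\ changes_sign (curvature g) s.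

Definition undulation (R : realType) (g : R -> R * R) (s : R) : Prop :=
  curvature g s = 0 /\ ~ changes_sign (curvature g) s.

(* S^1 is the unit circle of the plane, [circle s] its point of angle [s].  A map
   S^1 -> R^2 is represented by its (2 pi)-periodic lift R -> R^2, precomposition
   with [circle]; so [s] and [t] are the same parameter when
   [circle s = circle t]. *)
Definition circle {R : realType} (s : R) : R * R := (cos s, sin s).

Definition torus {R : realType} (st : R * R) : (R * R) * (R * R) :=
  (circle st.1, circle st.2).

Definition closed_regular_curve (R : realType) (f : R -> R * R) : Prop :=
  [/\ smooth f,
      forall s, f (s + 2 * pi) = f s &
      forall s, f^`() s <> 0].

Definition parallel_pair (R : realType) (f : R -> R * R) (s t : R) : Prop :=
  f s <> f t /\ det2 (f^`() s) (f^`() t) = 0.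

Definition same_direction (R : realType) (g1 g2 : R -> R * R) (s1 s2 : R) :
    Prop :=
  exists2 alpha : R, 0 < alpha & derive1 g1 s1 = alpha *: derive1 g2 s2.

(* [f \o phi] is a local arc length parameterization of the curve of [f] near
   [f s], of either direction, with [f s] at parameter 0. *)
Definition arc_length_change (R : realType) (f : R -> R * R) (s : R)
    (phi : R -> R) : Prop :=
  [/\ smooth phi, phi 0 = s &
      \forall u \near (0 : R), enorm ((f \o phi)^`() u) = 1].

Record generic (R : realType) (f : R -> R * R) : Prop := Generic {
  generic_regular : forall s, f^`() s <> 0;
  generic_inflexion :
    forall s, inflexion f s -> det2 (f^`() s) (f^`(3) s) <> 0;
  generic_undulation : forall s, ~ undulation f s;
  generic_crossing : forall s t, circle s <> circle t -> f s = f t ->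
    det2 (f^`() s) (f^`() t) <> 0;
  generic_parallel : forall s t, parallel_pair f s t ->
    ~ (inflexion f s /\ inflexion f t);
  generic_curvature : forall (s1 s2 : R) (phi1 phi2 : R -> R),
    parallel_pair f s1 s2 ->
    arc_length_change f s1 phi1 -> arc_length_change f s2 phi2 ->
    same_direction (f \o phi1) (f \o phi2) 0 0 ->
    curvature (f \o phi1) 0 = curvature (f \o phi2) 0 ->
    (curvature (f \o phi1))^`() 0 <> (curvature (f \o phi2))^`() 0
}.

(* The set Sigma, as a subset of the torus S^1 * S^1 in R^2 * R^2. *)
Definition parallel_set (R : realType) (f : R -> R * R) :
    set ((R * R) * (R * R)) :=
  closure (torus @` [set st : R * R |
    circle st.1 <> circle st.2 /\ det2 (f^`() st.1) (f^`() st.2) = 0]).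

(* A branch is identified with its domain, a component of Sigma, so that
   branches with the same image in the plane remain distinct. *)
Definition branch (R : realType) (f : R -> R * R)
    (C : set ((R * R) * (R * R))) : Prop :=
  exists2 p, parallel_set f p & C = connected_component (parallel_set f) p.

Definition secant (R : realType) (f : R -> R * R) (st : R * R) : R * R :=
  f st.1 - f st.2.

Definition branch_image (R : realType) (f : R -> R * R)
    (C : set ((R * R) * (R * R))) : set (R * R) :=
  secant f @` (torus @^-1` C).

(* [torus \o sigma] induces a smooth regular bijection from S^1 onto [C]. *)
Definition closed_parameterization (R : realType)
    (C : set ((R * R) * (R * R))) (sigma : R -> R * R) : Prop :=
  [/\ smooth sigma,
      forall u, sigma^`() u <> 0,
      forall u v, torus (sigma u) = torus (sigma v) <-> circle u = circle v &
      range (torus \o sigma) = C].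

Definition is_closed_curve (R : realType) (C : set ((R * R) * (R * R))) :
    Prop :=
  exists sigma : R -> R * R, closed_parameterization C sigma.

Definition center_of_symmetry (R : realType) (c : R * R) (X : set (R * R)) :
    Prop :=
  forall a, X a -> X (2 *: c - a).

(* The visits of the origin are counted by parameters in S^1. *)
Definition twice_inflexion_at_origin (R : realType) (f : R -> R * R)
    (C : set ((R * R) * (R * R))) : Prop :=
  exists sigma : R -> R * R,
    [/\ closed_parameterization C sigma,
        (circle @` [set u | secant f (sigma u) = 0] #= `I_2)%card &
        forall u, secant f (sigma u) = 0 -> inflexion (secant f \o sigma) u].

(* Main.v *)
Require Import Defs.
From mathcomp Require Import finmap all_boot all_order all_algebra.
From mathcomp Require Import all_classical all_reals all_analysis.
From mathcomp Require Import zify ring lra.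
Set Implicit Arguments.
Unset Strict Implicit.
Unset Printing Implicit Defensive.
Import Order.TTheory GRing.Theory Num.Theory.
Import numFieldNormedType.Exports.
Local Open Scope ring_scope.
Local Open Scope classical_set_scope.

(* In the plane of pairs (s, t), the set Sigma lifts to the closed, periodic set
   E of parallel pairs of distinct parameters together with the diagonal points
   (s, s) at inflexions.  E is locally a graph: away from the diagonal because
   two distinct parallel points are not both inflexions, and at (s, s) because,
   by the Morse lemma, the slope of the velocity is k m^2 there.  Hence
   every point of E lies on a complete unit-speed arc, unique up to
   reparameterization; modulo the lattice of periods its range is the whole
   component, and it is periodic by compactness.

   The swap (s, t) -> (t, s) preserves E and changes the sign of f s - f t, which
   vanishes on E only at the diagonal points.  An arc g of period T with g 0 on
   the diagonal satisfies g (- h) = swap (g h) up to a lattice vector, so it meets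
   the diagonal exactly when 2 h is a multiple of T: its branch is symmetric
   about the origin and visits it twice, at an inflexion since the acceleration
   determinant of the secant is a positive multiple of K s s' near the
   visit, K being the one of f.  Each such branch accounts for exactly two of the
   2 n inflexions of f. *)

(** Two devices shape the proof. First, the two-variable equation [D s t = 0] separates: measured
    from a fixed direction, it says that one function [slope] takes equal values at [s] and [t].
    Inverting that function takes the place of an implicit function theorem. At an inflexion, where
    the diagonal crosses the other solution curve, the Morse form separates the two; non-degeneracy
    enters there, as the second derivative of the slope is a nonzero multiple of det(f', f''').
    Second, unit speed makes arcs rigid: two arcs in the lift with a common point differ by a shift
    and a sign of the parameter. The global statements come down to deciding that sign. When an arc
    meets a lattice translate of itself the sign is +1, which yields a period; when it meets its
    swapped copy on the diagonal the sign is -1, which yields the symmetry. Working in the plane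
    turns the periods of the torus into translations, so that both comparisons are between arcs of
    one set. The theory of arcs is developed for any closed, lattice-periodic, locally graphical set
    [S]. *)

Lemma filterS4 (T : Type) (F : set_system T) (FF : Filter F) (P1 P2 P3 P4 Q : set T) :
  (forall x, P1 x -> P2 x -> P3 x -> P4 x -> Q x) ->
  F P1 -> F P2 -> F P3 -> F P4 -> F Q.
Proof.
move=> PQ F1 F2 F3 F4.
by apply: filterS3 F1 F2 (filterI F3 F4) => x p1 p2 [p3 p4]; exact: PQ.
Qed.

(** * Germs of smooth functions *)

Section Ck.
Variable R : realType.
Implicit Types (f g h : R -> R) (x y : R) (n : nat).

(* Regularity of the germ of [g] at [x]: only values near [x] matter, and the
   neighbourhood may shrink as [n] grows. *)
Fixpoint Ck n g x : Prop :=
  if n is m.+1 then (\forall y \near x, derivable g y 1) /\ Ck m g^`() x else True.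

Definition smooth_at g x := forall n, Ck n g x.

Lemma derive1_val (V : normedModType R) (f : R -> V) x l : is_derive x 1 f l -> f^`() x = l.
Proof. by case=> ? <-; rewrite derive1E. Qed.

Lemma derive1_is_derive (V : normedModType R) (f : R -> V) x :
  derivable f x 1 -> is_derive x 1 f (f^`() x).
Proof. by move=> df; rewrite derive1E; exact: derivableP. Qed.

Lemma near_eq_derive1 f g x : {near x, f =1 g} -> {near x, f^`() =1 g^`()}.
Proof.
move=> /near_join; apply: filterS => y fg.
by rewrite !derive1E; exact: near_eq_derive.
Qed.

Lemma Ck_eq n f g x : {near x, f =1 g} -> Ck n f x -> Ck n g x.
Proof.
elim: n f g => [//|n IH] f g fg /= [df cf]; split; last first.
  exact: IH (near_eq_derive1 fg) cf.
move: df; apply: filter_app; move/near_join: fg; apply: filterS => y fg.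
exact: near_eq_derivable.
Qed.

Lemma CkW n f x : Ck n.+1 f x -> Ck n f x.
Proof. by elim: n f => [//|n IH] f [df cf]; split => //; exact: IH. Qed.

Lemma Ck_derivable n f x : Ck n.+1 f x -> \forall y \near x, is_derive (y : R) 1 f (f^`() y).
Proof. by case=> + _; apply: filterS => y; exact: derive1_is_derive. Qed.

Lemma CkS n f g x : (\forall y \near x, is_derive (y : R) 1 f (g y)) -> Ck n g x ->
  Ck n.+1 f x.
Proof.
move=> fg cg; split; first by apply: filterS fg => y [].
by apply: Ck_eq cg; apply: filterS fg => y /derive1_val.
Qed.

Lemma Ck_le m n f x : (m <= n)%N -> Ck n f x -> Ck m f x.
Proof.
move=> /subnK <-; elim: (n - m)%N => [//|k IH]; rewrite addSn => /CkW.
exact: IH.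
Qed.

Lemma CkD n f g x : Ck n f x -> Ck n g x -> Ck n (f \+ g) x.
Proof.
elim: n f g => [//|n IH] f g cf cg.
apply: (@CkS _ _ (f^`() \+ g^`())); last by apply: IH; [case: cf|case: cg].
move: (Ck_derivable cf) (Ck_derivable cg); apply: filterS2 => y.
exact: is_deriveD.
Qed.

Lemma CkM n f g x : Ck n f x -> Ck n g x -> Ck n (f \* g) x.
Proof.
elim: n f g => [//|n IH] f g cf cg.
apply: (@CkS _ _ ((f \* g^`()) \+ (g \* f^`()))).
  move: (Ck_derivable cf) (Ck_derivable cg); apply: filterS2 => y.
  exact: is_deriveM.
by apply: CkD; apply: IH; try exact: CkW; [case: cg|case: cf].
Qed.

Lemma Ck_cst n (c : R) x : Ck n (cst c) x.
Proof.
elim: n c => [//|n IH] c; apply: (CkS _ (IH 0)).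
by apply: filterE => y; exact: is_derive_cst.
Qed.

Lemma Ck_id n x : Ck n id x.
Proof.
case: n => [//|n]; apply: (CkS _ (Ck_cst n 1 x)).
by apply: filterE => y; exact: is_derive_id.
Qed.

Lemma CkN n f x : Ck n f x -> Ck n (fun y => - f y) x.
Proof.
move=> cf; apply: (@Ck_eq _ (cst (-1) \* f)); last exact/CkM/cf/Ck_cst.
by apply: filterE => y /=; rewrite mulN1r.
Qed.

Lemma is_derive_continuous f x l : is_derive x 1 f l -> {for x, continuous f}.
Proof. by case=> df _; exact/differentiable_continuous/derivable1_diffP. Qed.

Lemma Ck_continuous n f x : Ck n.+1 f x -> {for x, continuous f}.
Proof. by move=> /Ck_derivable/nbhs_singleton/is_derive_continuous. Qed.

Lemma continuous_neq0 f x : {for x, continuous f} -> f x != 0 ->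
  \forall y \near x, f y != 0.
Proof. by rewrite /continuous_at => fc fx; exact: (cvgr_neq0 _ fc). Qed.

Lemma near_comp (T U : topologicalType) (g : T -> U) (t : T) (P : U -> Prop) :
  {for t, continuous g} -> (\forall y \near g t, P y) -> \forall y \near t, P (g y).
Proof. by move=> gc; exact: gc. Qed.

Lemma near_comp_at (T U : topologicalType) (g : T -> U) (t : T) (u : U) (P : U -> Prop) :
  {for t, continuous g} -> g t = u -> (\forall y \near u, P y) ->
  \forall y \near t, P (g y).
Proof. by move=> gc <-; exact: near_comp. Qed.

Lemma CkV n f x : f x != 0 -> Ck n f x -> Ck n (fun y => (f y)^-1) x.
Proof.
elim: n => [//|n IH] fx0 cf.
have cV := IH fx0 (CkW cf).
apply: (@CkS _ _ (fun y => - ((f y)^-1 * (f y)^-1 * f^`()%classic y))); last first.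
  by apply/CkN/CkM; [exact: CkM|case: cf].
move: (Ck_derivable cf) (continuous_neq0 (Ck_continuous cf) fx0).
apply: filterS2 => y dy fy0; apply: is_derive_eq (is_deriveV fy0 dy) _.
by rewrite /GRing.scale /= expr2 invfM mulNr.
Qed.

Lemma Ck_comp n f g x : Ck n g x -> Ck n f (g x) -> Ck n (f \o g) x.
Proof.
elim: n f g => [//|n IH] f g cg cf.
apply: (@CkS _ _ ((f^`() \o g) \* g^`())); last first.
  by apply: CkM; [apply: IH; [exact: CkW|case: cf]|case: cg].
move: (Ck_derivable cg) (Ck_continuous cg (Ck_derivable cf)).
by apply: filterS2 => y dg df; exact: is_derive1_comp.
Qed.

Lemma Ck_sqrt n x : 0 < x -> Ck n (@Num.sqrt R) x.
Proof.
elim: n x => [//|n IH] x x0.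
apply: (@CkS _ _ (fun y => ((cst 2 \* @Num.sqrt R) y)^-1)); last first.
  apply: CkV; first by rewrite /= mulf_neq0 ?pnatr_eq0// gt_eqF// sqrtr_gt0.
  by apply: CkM; [exact: Ck_cst|exact: IH].
by apply: filterS (lt_nbhsr x0) => y y0; exact: is_derive1_sqrt.
Qed.

(** The derivative of [g] is the inverse of that of [f], taken at [g]; so each order of regularity
    of [g] yields the next one, up to that of [f]. The order is at least 2 so that the derivative of
    [f] is continuous and stays nonzero near [x]. *)
Lemma Ck_inverse n f g x : {near x, cancel f g} -> f^`() x != 0 ->
  Ck n.+2 f x -> Ck n.+2 g (f x).
Proof.
move=> fgK dfx0 cf.
have cfn : \forall y \near x, {for y, continuous f}.
  by apply: filterS (Ck_derivable cf) => y; exact: is_derive_continuous.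
have [gc gfK] := near_can_continuousAcan_sym fgK cfn.
have gfx : g (f x) = x by exact: (nbhs_singleton fgK).
have cf' : Ck n.+1 f^`() x by case: cf.
have dgn : \forall y \near f x, is_derive (y : R) 1 g (f^`()%classic (g y))^-1.
  have dgf : \forall y \near f x, is_derive (f (g y) : R) 1 g (f^`()%classic (g y))^-1.
    have gcx : {for f x, continuous g} by exact: nbhs_singleton gc.
    apply: (near_comp (P := fun y => is_derive (f y : R) 1 g (f^`()%classic y)^-1) gcx).
    rewrite gfx.
    move: (near_join fgK) (near_join cfn) (Ck_derivable cf).
    move: (continuous_neq0 (Ck_continuous cf') dfx0).
    by apply: filterS4 => y ? ? ? ?; exact: is_derive_inverse.
  by move: gfK dgf; apply: filterS2 => y ->.
have cg0 : Ck 1 g (f x) by apply: CkS dgn _.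
suff : forall m, (m <= n.+1)%N -> Ck m.+1 g (f x) by apply.
elim=> [//|m IH] mn; apply: CkS dgn _.
apply: CkV; first by rewrite gfx.
apply: Ck_comp; first by apply: IH; exact: ltnW.
by rewrite gfx; exact: Ck_le cf'.
Qed.

Lemma smooth_atD f g x : smooth_at f x -> smooth_at g x -> smooth_at (f \+ g) x.
Proof. by move=> cf cg n; exact: CkD. Qed.

Lemma smooth_atM f g x : smooth_at f x -> smooth_at g x -> smooth_at (f \* g) x.
Proof. by move=> cf cg n; exact: CkM. Qed.

Lemma smooth_atN f x : smooth_at f x -> smooth_at (fun y => - f y) x.
Proof. by move=> cf n; exact: CkN. Qed.

Lemma smooth_at_cst (c : R) x : smooth_at (cst c) x.
Proof. by move=> n; exact: Ck_cst. Qed.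

Lemma smooth_at_id x : smooth_at id x.
Proof. by move=> n; exact: Ck_id. Qed.

Lemma smooth_atV f x : f x != 0 -> smooth_at f x ->
  smooth_at (fun y => (f y)^-1) x.
Proof. by move=> fx0 cf n; exact: CkV. Qed.

Lemma smooth_at_comp f g x : smooth_at g x -> smooth_at f (g x) ->
  smooth_at (f \o g) x.
Proof. by move=> cg cf n; exact: Ck_comp. Qed.

Lemma smooth_at_sqrt f x : 0 < f x -> smooth_at f x ->
  smooth_at (fun y => Num.sqrt (f y)) x.
Proof. by move=> fx0 cf n; apply: (@Ck_comp n Num.sqrt f) => //; exact: Ck_sqrt. Qed.

Lemma smooth_at_inverse f g x : {near x, cancel f g} -> f^`() x != 0 ->
  smooth_at f x -> smooth_at g (f x).
Proof. by move=> fgK dfx0 cf n; apply/CkW/CkW/Ck_inverse. Qed.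

Lemma smooth_at_eq f g x : {near x, f =1 g} -> smooth_at f x -> smooth_at g x.
Proof. by move=> fg cf n; exact: Ck_eq (cf n). Qed.

Lemma smooth_at_derive1 f x : smooth_at f x -> smooth_at f^`() x.
Proof. by move=> cf n; case: (cf n.+1). Qed.

Lemma smooth_atS f g x : (\forall y \near x, is_derive (y : R) 1 f (g y)) ->
  smooth_at g x -> smooth_at f x.
Proof. by move=> fg cg [//|n]; exact: CkS fg (cg n). Qed.

Lemma smooth_at_continuous f x : smooth_at f x -> {for x, continuous f}.
Proof. by move=> /(_ 1%N)/Ck_continuous. Qed.

Lemma smooth_at_is_derive f x : smooth_at f x -> is_derive (x : R) 1 f (f^`() x).
Proof. by move=> /(_ 1%N)/Ck_derivable/nbhs_singleton. Qed.

(** Smoothness is assumed near [x], since [smooth_at] at one point does not spread to its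
    neighbours: the neighbourhoods may shrink with the order. Local injectivity is Rolle's theorem,
    as two equal values would give a zero of the derivative. *)
Lemma local_inverse f x : (\forall y \near x, smooth_at f y) -> f^`() x != 0 ->
  exists g, [/\ {near x, cancel f g}, {near f x, cancel g f} &
    \forall y \near f x, smooth_at g y].
Proof.
move=> sf dfx0.
have sfx : smooth_at f x by exact: nbhs_singleton sf.
have cf' := smooth_at_continuous (smooth_at_derive1 sfx).
have df0 := continuous_neq0 cf' dfx0.
have cfn : \forall y \near x, {for y, continuous f}.
  by apply: filterS sf => y; exact: smooth_at_continuous.
have : exists2 e : R, 0 < e & forall y z, `|x - y| < e -> `|x - z| < e -> f y = f z -> y = z.
  have [e /= e0 He] := (nbhs_ballP _ _).1 (filterI sf df0); exists e => // y z.
  wlog yz : y z / y < z.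
    move=> H ye ze fyz; have [yz|zy|//] := ltgtP y z; first exact: H.
    by apply/esym; apply: H.
  move=> ye ze fyz.
  have yze w : w \in `[y, z]%R -> ball x e w.
    rewrite in_itv/= /ball/= => /andP[yw wz]; move: ye ze.
    rewrite !ltr_norml => /andP[? ?] /andP[? ?].
    by apply/andP; split; lra.
  have [w||w wyz] := @Rolle _ f y z yz _ _ fyz.
  - by move=> wyz; have [/smooth_at_is_derive[]] := He _ (yze _ (subset_itv_oo_cc wyz)).
  - apply: derivable_within_continuous => w /yze/He[/smooth_at_is_derive[]//].
  - move=> /derive1_val; have [_ /eqP] := He _ (yze _ (subset_itv_oo_cc wyz)).
    by [].
move=> [e e0 finj].
pose g z := xget x [set y | `|x - y| < e /\ f y = z].
have fgK : {near x, cancel f g}.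
  apply/nbhs_ballP; exists e => // y ye.
  rewrite /g; case: xgetP => [w _ [we]|/(_ y)]; last by case.
  by move=> /finj; apply.
have [_ gfK] := near_can_continuousAcan_sym fgK cfn.
exists g; split=> //.
have sgf : \forall y \near f x, smooth_at g (f (g y)).
  have gcx : {for f x, continuous g}.
    by have /nbhs_singleton := near_can_continuous fgK cfn.
  apply: (near_comp (P := fun y => smooth_at g (f y)) gcx); rewrite (nbhs_singleton fgK).
  move: (near_join fgK) df0 sf; apply: filterS3 => y; exact: smooth_at_inverse.
by move: gfK sgf; apply: filterS2 => y ->.
Qed.

End Ck.

(** * Hadamard and Morse lemmas *)

Section Calculus.
Variable R : realType.
Implicit Types (f g h w A : R -> R) (x y c l : R) (n m : nat).

Lemma local_primitive w x : (\forall y \near x, {for y, continuous w}) ->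
  exists2 L : R -> R, L x = 0 & \forall y \near x, is_derive (y : R) 1 L (w y).
Proof.
move=> /nbhs_ballP[e /= e0 we].
have inball y : y \in `[x - e / 2, x + e / 2]%R -> {for y, continuous w}.
  rewrite in_itv/= => /andP[? ?]; apply: we; rewrite /ball/= ltr_norml.
  by apply/andP; split; lra.
(* Integrating from [x - e / 2] rather than from [x] puts [x] in the interior, where the fundamental
   theorem gives a two-sided derivative. *)
pose F y := (\int[@lebesgue_measure R]_(t in [set` `[x - e / 2, y]%R]) w t)%R.
exists (fun y => F y - F x); first by rewrite subrr.
have : \forall y \near x, y \in `](x - e / 2), (x + e / 2)[%R.
  by apply: near_in_itvoo; rewrite in_itv/=; apply/andP; split; lra.
apply: filterS => y; rewrite in_itv/= => /andP[ay yb].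
have [||dF] := @continuous_FTC1_closed R w (x - e / 2) y (x + e / 2) yb _ ay.
- apply: continuous_compact_integrable; first exact: segment_compact.
  by apply: continuous_in_subspaceT => z; rewrite inE/= => /inball.
- by apply: inball; rewrite in_itv/= !ltW.
move=> /esym wE; rewrite -[w y]subr0; apply: is_deriveB.
by rewrite wE; exact: derive1_is_derive.
Qed.

Lemma is_derive_cvg (V : normedModType R) (g : R -> V) x (l : V) :
  is_derive x 1 g l <-> h^-1 *: (g (h + x) - g x) @[h --> 0^'] --> l.
Proof.
have E : (fun h : R => h^-1 *: ((g \o shift x) (h *: 1) - g x)) =
    (fun h : R => h^-1 *: (g (h + x) - g x)).
  by apply/funext => h /=; rewrite [h *: 1]mulr1.
split=> [[dg <-]|gl]; first by rewrite -E; exact: dg.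
rewrite -E in gl.
by constructor; [apply: cvgP gl|exact: cvg_lim gl].
Qed.

Lemma is_derive_pair (g : R -> R * R) x (l : R * R) :
  is_derive x 1 g l <-> is_derive x 1 (fst \o g) l.1 /\ is_derive x 1 (snd \o g) l.2.
Proof.
rewrite !is_derive_cvg; split=> [gl|[g1 g2]].
  split.
    exact: (cvg_comp _ fst gl cvg_fst).
  exact: (cvg_comp _ snd gl cvg_snd).
rewrite [l]surjective_pairing.
exact: (cvg_pair g1 g2).
Qed.

Definition vsmooth_at (g : R -> R * R) x :=
  smooth_at (fst \o g) x /\ smooth_at (snd \o g) x.

Lemma vsmooth_is_derive (g : R -> R * R) x : vsmooth_at g x ->
  is_derive x 1 g ((fst \o g)^`()%classic x, (snd \o g)^`()%classic x).
Proof. by move=> [g1 g2]; apply/is_derive_pair; split; exact: smooth_at_is_derive. Qed.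

Lemma vsmooth_continuous (g : R -> R * R) x : vsmooth_at g x -> {for x, continuous g}.
Proof.
by move=> /vsmooth_is_derive[dg _]; exact/differentiable_continuous/derivable1_diffP.
Qed.

Lemma vsmooth_derive1 (g : R -> R * R) x :
  vsmooth_at g x -> g^`() x = ((fst \o g)^`()%classic x, (snd \o g)^`()%classic x).
Proof. by move=> /vsmooth_is_derive/derive1_val. Qed.

(** Links the iterated derivatives of a pair to the germs of its two coordinates; both directions go
    by induction through the derivative of [g]. *)
Lemma vsmoothP (g : R -> R * R) : smooth g <-> forall x, vsmooth_at g x.
Proof.
split=> [sg x|].
  suff: forall n, Ck n (fst \o g) x /\ Ck n (snd \o g) x.
    by move=> H; split=> n; have [] := H n.
  move=> n; elim: n g sg => [//|n IH] g sg.
  have dg (s : R) : is_derive s 1 (fst \o g) (g^`()%classic s).1 /\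
      is_derive s 1 (snd \o g) (g^`()%classic s).2.
    by apply/is_derive_pair; have := derive1_is_derive (sg 0%N s).
  have [|c1 c2] := IH g^`(); first by move=> k s; rewrite -derive1Sn.
  split; [apply: CkS c1|apply: CkS c2]; apply: filterE => y; by have [] := dg y.
move=> sg n; elim: n g sg => [|n IH] g sg s.
  by have [] := vsmooth_is_derive (sg s).
rewrite derive1Sn; apply: IH => x.
have -> : g^`() = (fun y => ((fst \o g)^`()%classic y, (snd \o g)^`()%classic y)).
  by apply/funext => y; rewrite vsmooth_derive1.
by have [s1 s2] := sg x; split; exact: smooth_at_derive1.
Qed.

Lemma near_at_left x (P : R -> Prop) :
  (\forall z \near x, P z) -> \forall z \near x^'-, P z.
Proof. exact: (cvg_at_left_filter cvg_id). Qed.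

Lemma near_at_right x (P : R -> Prop) :
  (\forall z \near x, P z) -> \forall z \near x^'+, P z.
Proof. exact: (cvg_at_right_filter cvg_id). Qed.

Lemma derive_neq0_loc_inj (h : R -> R) (c l : R) : is_derive c 1 h l -> l != 0 ->
  \forall u \near c, h u = h c -> u = c.
Proof.
move=> /is_derive1_caratheodory[q [qE qc <-]] /(continuous_neq0 qc).
apply: filterS => u qu0 fu; have := qE u; rewrite fu subrr => /esym/eqP.
by rewrite mulf_eq0 (negbTE qu0)/= subr_eq0 => /eqP.
Qed.

Lemma derive_neq0_changes_sign h x l : is_derive x 1 h l -> l != 0 -> h x = 0 ->
  changes_sign h x.
Proof.
move=> /is_derive1_caratheodory[g [hE gc gx]] l0 hx0.
have {}hE z : h z = g z * (z - x) by rewrite -hE hx0 subr0.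
have lt_right : \forall z \near x^'+, 0 < z - x.
  by near=> z; rewrite subr_gt0; near: z; exact: nbhs_right_gt.
have lt_left : \forall z \near x^'-, z - x < 0.
  by near=> z; rewrite subr_lt0; near: z; exact: nbhs_left_lt.
have [lp|ln|l00] := ltgtP 0 l; last by rewrite -l00 eqxx in l0.
  have gp : \forall z \near x, 0 < g z.
    by rewrite -gx in lp; exact: (cvgr_gt _ gc).
  left; split; [move: lt_left|move: lt_right].
    have := near_at_left gp.
    by apply: filterS2 => z g0 zx; rewrite hE pmulr_rlt0.
  have := near_at_right gp.
  by apply: filterS2 => z g0 zx; rewrite hE mulr_gt0.
have gp : \forall z \near x, g z < 0.
  by rewrite -gx in ln; exact: (cvgr_lt _ gc).
right; split; [move: lt_left|move: lt_right].
  have := near_at_left gp.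
  by apply: filterS2 => z g0 zx; rewrite hE nmulr_rgt0.
have := near_at_right gp.
by apply: filterS2 => z g0 zx; rewrite hE nmulr_rlt0.
Unshelve. all: by end_near. Qed.

Lemma near_lt_gt (F : set_system R) {FF : ProperFilter F} h :
  F (fun z => 0 < h z) -> F (fun z => h z < 0) -> False.
Proof.
move=> hp hn; have /filter_ex[] // : F (fun=> False).
by move: hp hn; apply: filterS2 => z /lt_trans/[apply]; rewrite ltxx.
Qed.

Lemma changes_sign_eq0 h x : {for x, continuous h} -> changes_sign h x -> h x = 0.
Proof.
move=> hc hs; apply/eqP/negPn/negP => hx0.
have [hp|hn|l00] := ltgtP 0 (h x); last by rewrite -l00 eqxx in hx0.
  have gp : \forall z \near x, 0 < h z by exact: (cvgr_gt _ hc).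
  have [gl gr] := (near_at_left gp, near_at_right gp).
  case: hs => [[hl _]|[_ hr]].
    exact: (@near_lt_gt x^'- _ h gl hl).
  exact: (@near_lt_gt x^'+ _ h gr hr).
have gp : \forall z \near x, h z < 0 by exact: (cvgr_lt _ hc).
have [gl gr] := (near_at_left gp, near_at_right gp).
case: hs => [[_ hr]|[hl _]].
  exact: (@near_lt_gt x^'+ _ h hr gr).
exact: (@near_lt_gt x^'- _ h hl gl).
Qed.

Lemma derD f g x a b : is_derive x 1 f a -> is_derive x 1 g b ->
  is_derive x 1 (fun y => f y + g y) (a + b).
Proof. exact: is_deriveD. Qed.

Lemma derB f g x a b : is_derive x 1 f a -> is_derive x 1 g b ->
  is_derive x 1 (fun y => f y - g y) (a - b).
Proof. exact: is_deriveB. Qed.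

Lemma derM f g x a b : is_derive x 1 f a -> is_derive x 1 g b ->
  is_derive x 1 (fun y => f y * g y) (a * g x + f x * b).
Proof.
move=> fa gb; have := is_deriveM fa gb.
by rewrite /GRing.scale/= addrC [g x * a]mulrC.
Qed.

Lemma derZ f x a c : is_derive x 1 f a -> is_derive x 1 (fun y => c * f y) (c * a).
Proof. exact: is_deriveZ. Qed.

Lemma derV f x a : is_derive x 1 f a -> f x != 0 ->
  is_derive x 1 (fun y => (f y)^-1) (- (f x) ^- 2 * a).
Proof. by move=> fa fx0; exact: is_deriveV. Qed.

Lemma derComp f g x a b : is_derive (g x) 1 f a -> is_derive x 1 g b ->
  is_derive x 1 (fun y => f (g y)) (a * b).
Proof. exact: is_derive1_comp. Qed.

Lemma derBc x c : is_derive x 1 (fun y => y - c) 1.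
Proof. by apply: is_derive_eq (derB _ _) _; rewrite ?subr0. Qed.

(* Satisfied by A x = \int_0^1 t^n h (c + t (x - c)) dt, whose derivative is the
   function of the same form for h' and n + 1; the differential equation
   replaces the integral. *)
Definition hadamard_data n h A c := [/\ \forall x \near c, smooth_at h x,
  {for c, continuous A}, A c = h c / n.+1%:R &
  \forall x \near c, x != c -> is_derive (x : R) 1 A ((h x - n.+1%:R * A x) / (x - c))].

(** The differential equation says nothing at [c] itself. There l'Hopital's rule applies to
    [(x - c)^(n+1) (A x - A c)] over [(x - c)^(n+2)]: by the equation the numerator has derivative
    [(x - c)^n (h x - h c)], so the limit is the derivative of [h] at [c] divided by [n + 2]. *)
Lemma hadamard_step n h A c : hadamard_data n h A c ->
  exists A', hadamard_data n.+1 h^`() A' c /\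
             \forall x \near c, is_derive (x : R) 1 A (A' x).
Proof.
move=> [sh cA Ac dA].
have hc := nbhs_singleton sh.
have /is_derive1_caratheodory[q [qE qc qx]] := smooth_at_is_derive hc.
have n1 : n.+1%:R != 0 :> R by rewrite pnatr_eq0.
have n2 : n.+2%:R != 0 :> R by rewrite pnatr_eq0.
have hcE : h c = n.+1%:R * A c by rewrite Ac mulrC divfK.
pose l : R := derive1 h c / n.+2%:R.
have dAc : is_derive c 1 A l.
  pose u x := (x - c) ^+ n.+1 * (A x - A c).
  pose du x : R := if x == c then l else (x - c) ^+ n * (h x - h c).
  pose v x := (x - c) ^+ n.+2.
  pose dv x := if x == c then 1 else n.+2%:R * (x - c) ^+ n.+1.
  have dX k x : is_derive (x : R) 1 (fun y => (y - c) ^+ k.+1) (k.+1%:R * (x - c) ^+ k).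
    have d0 := derBc x c.
    have dX : is_derive (x - c) 1 (@GRing.exp R ^~ k.+1) (k.+1%:R * (x - c) ^+ k).
      apply: DeriveDef; first exact: exprn_derivable.
      by rewrite exp_derive /GRing.scale/= mulr1.
    rewrite -[X in is_derive _ _ _ X]mulr1.
    exact: (@is_derive1_comp _ (fun z : R => z ^+ k.+1) (fun y => y - c) x _ _ dX d0).
  have [e /= e0 He] := (nbhs_ballP _ _).1 dA.
  have uv : u x / v x @[x --> c^'] --> l.
    apply: (@lhopital R u du v dv (c - e) (c + e) c l).
    - by rewrite in_itv/=; apply/andP; split; lra.
    - move=> x; rewrite !inE/= in_itv/= => -[/andP[xa xb] /eqP xc].
      have xe : ball c e x by rewrite /ball/= ltr_norml; apply/andP; split; lra.
      have dAx := He x xe xc.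
      have dAcx : is_derive x 1 (fun y => A y - A c) ((h x - n.+1%:R * A x) / (x - c)).
        by apply: is_derive_eq (is_deriveB _ _) _; rewrite subr0.
      apply: is_derive_eq (is_deriveM (dX n x) dAcx) _.
      rewrite /du (negbTE xc) /GRing.scale/= hcE exprS.
      have xc0 : x - c != 0 by rewrite subr_eq0.
      by field.
    - move=> x; rewrite !inE/= in_itv/= => -[_ /eqP xc].
      by rewrite /dv (negbTE xc); exact: dX.
    - have : {for c, continuous u}.
        apply: continuousM; first exact: is_derive_continuous (dX n c).
        by apply: continuousB => //; exact: cst_continuous.
      have uc0 : u c = 0 by rewrite /u !subrr mulr0.
      by move=> uc; rewrite -[X in _ --> X]uc0; exact: uc.
    - have : {for c, continuous v} by exact: is_derive_continuous (dX n.+1 c).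
      have vc0 : v c = 0 by rewrite /v subrr exprS mul0r.
      by move=> vc; rewrite -[X in _ --> X]vc0; exact: vc.
    - move=> x; rewrite !inE/= in_itv/= => -[_ /eqP xc].
      by rewrite /dv (negbTE xc) mulf_neq0// expf_neq0// subr_eq0.
    - have -> : (fun x => du x / dv x) = (fun x => q x / n.+2%:R).
        apply/funext => x; rewrite /du /dv; case: eqP => [->|/eqP xc].
          by rewrite divr1 qx.
        have xc0 : x - c != 0 by rewrite subr_eq0.
        rewrite qE exprS; field; rewrite xc0 expf_neq0//=.
        by rewrite -natrD pnatr_eq0.
      by rewrite /l -qx; apply: cvgMl; exact: qc.
  apply/is_derive1_caratheodory.
  exists (fun z => if z == c then l else (A z - A c) / (z - c)); split.
  - move=> z; case: eqP => [->|/eqP]; first by rewrite !subrr mulr0.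
    by rewrite -subr_eq0 => /divfK->.
  - apply/continuous_withinNx; rewrite eqxx.
    apply: cvg_trans uv; apply: near_eq_cvg; near=> z.
    have zc : z != c by near: z; exact: nbhs_dnbhs_neq.
    rewrite (negbTE zc) /u /v [(z - c) ^+ n.+2]exprS.
    have zc0 : z - c != 0 by rewrite subr_eq0.
    by rewrite [X in X / _]mulrC -mulf_div divff ?expf_neq0// mulr1.
  - by rewrite eqxx.
have /is_derive1_caratheodory[r [rE rc rx]] := dAc.
(* Built from the difference quotients [q] and [r] of [h] and [A] at [c], this is continuous at [c]
   and agrees elsewhere with the right-hand side of the differential equation. *)
pose A' x := q x - n.+1%:R * r x.
have A'E z : z != c -> A' z = (h z - n.+1%:R * A z) / (z - c).
  move=> zc; have zc0 : z - c != 0 by rewrite subr_eq0.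
  apply: (mulIf zc0); rewrite divfK// /A' mulrBl -mulrA -qE -rE hcE; ring.
have A'c : A' c = derive1 h c / n.+2%:R.
  by rewrite /A' rx qx /l; field; rewrite -natrD pnatr_eq0.
exists A'; split; last first.
  move: dA; apply: filterS => x dAx; have [->|xc] := eqVneq x c.
    by rewrite A'c.
  by rewrite A'E//; exact: dAx.
split => //.
- by move: sh; apply: filterS => x; exact: smooth_at_derive1.
- by apply: continuousB => //; apply: continuousM => //; exact: cst_continuous.
- move: dA sh; apply: filterS2 => x dAx shx xc.
  have xc0 : x - c != 0 by rewrite subr_eq0.
  have dhx := smooth_at_is_derive shx.
  have {}dAx := dAx xc.
  have d0 := derBc x c.
  have near_neq : \forall z \near x, (h z - n.+1%:R * A z) / (z - c) = A' z.
    have := continuous_neq0 (is_derive_continuous d0) xc0.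
    by apply: filterS => z; rewrite subr_eq0 => zc; rewrite A'E.
  apply: near_eq_is_derive near_neq _.
  have d1 : is_derive x 1 (fun y : R => h y - n.+1%:R * A y)
      (derive1 h x - n.+1%:R * ((h x - n.+1%:R * A x) / (x - c))).
    by apply: is_deriveB => //; apply: is_deriveZ.
  refine (is_derive_eq (derM d1 (derV d0 xc0)) _).
  by rewrite A'E//; field.
Unshelve. all: by end_near. Qed.

Lemma hadamard_Ck k n h A c : hadamard_data n h A c -> Ck k A c.
Proof.
elim: k n h A => [//|k IH] n h A /hadamard_step[A' [/IH cA' dA]].
exact: CkS dA cA'.
Qed.

Lemma hadamard h c : (\forall x \near c, smooth_at h x) -> h c = 0 ->
  exists q, [/\ forall x, h x = (x - c) * q x, q c = h^`()%classic c &
    \forall x \near c, smooth_at q x].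
Proof.
move=> sh hc0.
have /is_derive1_caratheodory[q [qE qc qx]] := smooth_at_is_derive (nbhs_singleton sh).
have hE x : h x = (x - c) * q x by rewrite mulrC -qE hc0 subr0.
have qV x : x != c -> q x = h x / (x - c).
  by move=> xc; rewrite hE mulrAC divff ?mul1r// subr_eq0.
have near_qV x : x != c -> \forall z \near x, h z / (z - c) = q z.
  rewrite -subr_eq0 => /(continuous_neq0 (is_derive_continuous (derBc x c))).
  by apply: filterS => z; rewrite subr_eq0 => zc; rewrite qV.
exists q; split=> //.
have qcs : smooth_at q c.
  (* [q x] is the mean of the derivative of [h] between [c] and [x]: the case [n = 0] of the data,
     for that derivative. *)
  move=> k; apply: (@hadamard_Ck k 0 h^`() q); split=> //.
  - by move: sh; apply: filterS => x; exact: smooth_at_derive1.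
  - by rewrite divr1.
  - move: sh; apply: filterS => x shx xc.
    have xc0 : x - c != 0 by rewrite subr_eq0.
    apply: near_eq_is_derive (near_qV _ xc) _.
    refine (is_derive_eq (derM (smooth_at_is_derive shx) (derV (derBc x c) xc0)) _).
    by rewrite qV//; field.
move: sh; apply: filterS => x shx; have [->//|xc] := eqVneq x c.
apply: smooth_at_eq (near_qV _ xc) _; apply: smooth_atM => //.
apply: smooth_atV; first by rewrite subr_eq0.
by apply: smooth_atD; [exact: smooth_at_id|exact: smooth_at_cst].
Qed.

Lemma morse h c : (\forall x \near c, smooth_at h x) -> h c = 0 ->
  h^`() c = 0 -> h^`(2)%classic c != 0 ->
  exists (m : R -> R) (k : R), [/\ \forall x \near c, smooth_at m x, m c = 0,
    m^`()%classic c != 0, k != 0 & \forall x \near c, h x = k * m x ^+ 2].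
Proof.
move=> sh hc0 dhc0 ddhc0.
have [q [hE qc0 sq]] := hadamard sh hc0; rewrite dhc0 in qc0.
have [r [qE rc sr]] := hadamard sq qc0.
have rc0 : r c != 0.
  apply: contra_neq ddhc0 => rc0.
  have dq : \forall x \near c, is_derive (x : R) 1 h (q x + (x - c) * q^`()%classic x).
    move: sq; apply: filterS => x sqx.
    have := derM (derBc x c) (smooth_at_is_derive sqx); rewrite mul1r.
    by congr (is_derive _ _ _ _); apply/funext => y; rewrite hE.
  have : is_derive c 1 h^`() (q^`()%classic c + (1 * q^`()%classic c + (c - c) * q^`(2)%classic c)).
    have sqc := nbhs_singleton sq.
    have := derD (smooth_at_is_derive sqc)
      (derM (derBc c c) (smooth_at_is_derive (smooth_at_derive1 sqc))).
    by apply: near_eq_is_derive; move: dq; apply: filterS => x /derive1_val.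
  by move=> /derive1_val; rewrite -rc rc0 subrr mul0r mulr0 !addr0.
(* Two divisions give [h x = (x - c)^2 r x]. Normalizing by [r c] makes the radicand 1 at [c]
   whatever the sign of [r c], which becomes the constant [k]. *)
pose s x := r x / r c.
have sc1 : s c = 1 by rewrite /s divff.
have ss : \forall x \near c, smooth_at s x.
  by move: sr; apply: filterS => x srx; apply: smooth_atM => //; exact: smooth_at_cst.
have s0 : \forall x \near c, 0 < s x.
  have sc := smooth_at_continuous (nbhs_singleton ss).
  by apply: (cvgr_gt _ sc); rewrite sc1.
have sm : \forall x \near c, smooth_at (fun x => (x - c) * Num.sqrt (s x)) x.
  move: ss s0; apply: filterS2 => x ssx s0x; apply: smooth_atM; last exact: smooth_at_sqrt.
  by apply: smooth_atD; [exact: smooth_at_id|exact: smooth_at_cst].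
exists (fun x => (x - c) * Num.sqrt (s x)), (r c); split=> //.
- by rewrite subrr mul0r.
- have ds : is_derive c 1 (fun x => Num.sqrt (s x)) (derive1 (fun x => Num.sqrt (s x)) c).
    apply/smooth_at_is_derive/smooth_at_sqrt; first by rewrite sc1.
    exact: nbhs_singleton ss.
  rewrite (derive1_val (derM (derBc c c) ds)) subrr mul0r addr0 mul1r sc1 sqrtr1.
  exact: oner_neq0.
- move: s0; apply: filterS => x s0x.
  rewrite hE qE exprMn sqr_sqrtr ?ltW// /s; field.
  exact: rc0.
Qed.

End Calculus.

Lemma near_derive0_const (R : realType) (F : R -> R) (c : R) :
  (\forall u \near c, is_derive (u : R) 1 F 0) -> \forall u \near c, F u = F c.
Proof.
move=> /nbhs_ballP[e /= e0 dF]; apply/nbhs_ballP; exists e => //= u uc.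
have din (a b x : R) : ball c e a -> ball c e b -> x \in `[a, b]%R -> is_derive x 1 F 0.
  rewrite in_itv/= /ball/= => + + /andP[ax xb].
  rewrite !ltr_norml => /andP[? ?] /andP[? ?]; apply: dF.
  by rewrite /ball/= ltr_norml; apply/andP; split; lra.
have cc : ball c e c by exact: ballxx.
have H (a b : R) : ball c e a -> ball c e b -> a <= b -> F a = F b.
  move=> ea eb ab.
  have dF1 x : x \in `]a, b[%R -> is_derive x 1 F (cst 0 x).
    by move=> xab; apply: (din a b) => //; exact: subset_itv_oo_cc.
  have cF : {within `[a, b], continuous F}.
    by apply: derivable_within_continuous => x xab; have [] := din _ _ _ ea eb xab.
  have [x _] := MVT_segment ab dF1 cF.
  by rewrite mul0r => /eqP; rewrite subr_eq0 eq_sym => /eqP.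
by have [/H ->//|/ltW/H ->//] := leP u c.
Qed.

(** * Unit-speed arcs in a locally graphical set *)

Section Arcs.
Variable R : realType.
Implicit Types (S : set (R * R)) (p q : R * R) (g s : R -> R * R).

Definition speed2 g u : R := (fst \o g)^`()%classic u ^+ 2 + (snd \o g)^`()%classic u ^+ 2.

Definition arc_at S g u := [/\ S (g u), vsmooth_at g u & speed2 g u = 1].

Definition graph_at S p := exists phi : R -> R,
  (\forall s \near p.1, smooth_at phi s) /\
  (\forall q \near p, S q <-> q.2 = phi q.1).

(* Last clause: [g] is the only unit-speed arc in [S] through [p], up to the
   choice of origin and orientation. *)
Definition local_chart S p g := [/\ g 0 = p,
  \forall u \near (0 : R), arc_at S g u,
  forall d : R, 0 < d -> \forall q \near p, S q -> exists2 y : R, `|y| < d & g y = q &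
  forall s c, s c = p -> (\forall u \near c, arc_at S s u) ->
    exists2 e : R, e ^+ 2 = 1 & \forall u \near c, s u = g (e * (u - c))].

Lemma fst_continuous p : {for p, continuous fst}.
Proof. exact: cvg_fst. Qed.

Lemma snd_continuous p : {for p, continuous snd}.
Proof. exact: cvg_snd. Qed.

Lemma pair_continuous (T U V : topologicalType) (f : T -> U) (g : T -> V) x :
  {for x, continuous f} -> {for x, continuous g} ->
  {for x, continuous (fun y => (f y, g y))}.
Proof. move=> fc gc; exact: cvg_pair fc gc. Qed.

(** The chart is the graph run by arc length: [L] is a primitive of the length element [w], [M] is
    its inverse, and [g] lifts [M] to the graph. *)
Lemma graph_chart S p : S p -> graph_at S p -> exists g, local_chart S p g.
Proof.
case: p => s0 t0 Sp [phi [/= sphi Sphi]].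
pose p := (s0, t0).
have phi0 : phi s0 = t0 by have /= [/(_ Sp) ->] := nbhs_singleton Sphi.
pose w (s : R) : R := Num.sqrt (1 + (phi^`()%classic s) ^+ 2).
have w2 (s : R) : w s ^+ 2 = 1 + (phi^`()%classic s) ^+ 2.
  by rewrite sqr_sqrtr// addr_ge0// sqr_ge0.
have w0 (s : R) : 0 < w s by rewrite sqrtr_gt0 ltr_pwDl// sqr_ge0.
have sw : \forall s \near s0, smooth_at w s.
  move: sphi; apply: filterS => s ss; apply: smooth_at_sqrt.
    by rewrite ltr_pwDl// sqr_ge0.
  apply: smooth_atD; first exact: smooth_at_cst.
  by apply: smooth_atM; exact: smooth_at_derive1.
have [|L L0 dL] := @local_primitive R w s0.
  by move: sw; apply: filterS => s; exact: smooth_at_continuous.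
have sL : \forall s \near s0, smooth_at L s.
  by move: (near_join dL) sw; apply: filterS2 => s; exact: smooth_atS.
have [|M [LM ML sM]] := local_inverse sL.
  by rewrite (derive1_val (nbhs_singleton dL)) gt_eqF.
rewrite L0 in ML sM.
have {}LM : \forall s \near s0, M (L s) = s by exact: LM.
have M0 : M 0 = s0 by rewrite -L0; exact: (nbhs_singleton LM).
have Mc := smooth_at_continuous (nbhs_singleton sM).
have sphiM : \forall u \near (0 : R), smooth_at phi (M u).
  exact: near_comp_at Mc M0 sphi.
have dM : \forall u \near (0 : R), w (M u) * M^`()%classic u = 1.
  have dLM : \forall u \near (0 : R), is_derive (M u) 1 L (w (M u)).
    exact: near_comp_at Mc M0 dL.
  move: dLM sM (near_join ML); apply: filterS3 => u dLu sMu MLu.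
  rewrite -(derive1_val (derComp dLu (smooth_at_is_derive sMu))).
  by rewrite (nbhs_singleton (near_eq_derive1 MLu)) derive1_id.
pose g u := (M u, phi (M u)).
have gc : {for (0 : R), continuous g}.
  apply: pair_continuous => //.
  apply: smooth_at_continuous (smooth_at_comp (nbhs_singleton sM) _).
  exact: nbhs_singleton sphiM.
have g0 : g 0 = (s0, t0) by rewrite /g M0 phi0.
exists g; split => //.
- have Sg : \forall u \near (0 : R), S (g u) <-> (g u).2 = phi (g u).1.
    exact: near_comp_at gc g0 Sphi.
  move: Sg sM sphiM dM; apply: filterS4 => u Sgu sMu sphiu dMu; split.
  + exact/Sgu.
  + by split => //; exact: smooth_at_comp.
  + rewrite /speed2 -[fst \o g]/M -[snd \o g]/(phi \o M).
    rewrite (derive1_val (derComp (smooth_at_is_derive sphiu) (smooth_at_is_derive sMu))).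
    rewrite exprMn -{1}[_ ^+ 2]mul1r -mulrDl -w2 -exprMn dMu.
    by rewrite expr1n.
- move=> d d0.
  have Lc : {for p, continuous (L \o fst)}.
    apply: continuous_comp; first exact: fst_continuous.
    exact: smooth_at_continuous (nbhs_singleton sL).
  have nL : \forall q \near p, `|(L \o fst) q| < d.
    exact: (near_comp_at Lc L0 (nbhs0_lt d0)).
  have nM : \forall q \near p, M (L q.1) = q.1.
    exact: (near_comp_at (g := fst) (@fst_continuous p) (erefl s0) LM).
  move: Sphi nL nM; apply: filterS3 => -[s t] /= Sst Ls MLs /Sst ->.
  by exists (L s) => //; rewrite /g MLs.
- move=> s c sc As.
  have [sx sy] : vsmooth_at s c by have [] := nbhs_singleton As.
  pose x := fst \o s; pose y := snd \o s.
  have xc0 : x c = s0 by rewrite /x/= sc.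
  have cs : {for c, continuous s} by apply: vsmooth_continuous.
  have cx : {for c, continuous x} by exact: smooth_at_continuous.
  have xM : \forall u \near c, M (L (x u)) = x u.
    exact: near_comp_at cx xc0 LM.
  have dLx : \forall u \near c, is_derive (x u) 1 L (w (x u)).
    exact: near_comp_at cx xc0 dL.
  have sphix : \forall u \near c, smooth_at phi (x u).
    exact: near_comp_at cx xc0 sphi.
  have swx : \forall u \near c, smooth_at w (x u).
    exact: near_comp_at cx xc0 sw.
  have yphi : \forall u \near c, y u = phi (x u).
    have : \forall u \near c, S (s u) <-> (s u).2 = phi (s u).1.
      exact: near_comp_at cs sc Sphi.
    by move: As; apply: filterS2 => u [Ssu _ _] [/(_ Ssu)].
  (* [d] is the derivative of [L (x u)]. Unit speed makes its square 1 and continuity makes it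
     locally constant, so [L (x u)] is affine with slope [d c], the sign sought. *)
  pose d u := w (x u) * x^`()%classic u.
  have d2 : \forall u \near c, d u ^+ 2 = 1.
    move: As sphix (near_join yphi); apply: filterS3 => u [_ [sxu syu] v1] sphiu yu.
    rewrite /d exprMn w2 mulrDl mul1r -exprMn.
    rewrite -(derive1_val (derComp (smooth_at_is_derive sphiu) (smooth_at_is_derive sxu))).
    by rewrite -(nbhs_singleton (near_eq_derive1 yu)).
  have dc : {for c, continuous d}.
    apply: smooth_at_continuous; apply: smooth_atM; last exact: smooth_at_derive1.
    by apply: smooth_at_comp => //; exact: nbhs_singleton swx.
  have dcst : \forall u \near c, d u = d c.
    have := near_comp dc (nbhsx_ballx (d c) 1 ltr01).
    move: (d2); apply: filterS2 => u du2; rewrite /ball/= ltr_norml => /andP[? ?].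
    have := nbhs_singleton d2; rewrite -du2 => /eqP.
    rewrite eqf_sqr => /orP[/eqP//|/eqP dcu].
    by move: du2; rewrite -[X in _ = X](expr1n _ 2) => /eqP; rewrite eqf_sqr => /orP[] /eqP; lra.
  have Nx : \forall u \near c, L (x u) - d c * (u - c) = L (x c) - d c * (c - c).
    apply: (@near_derive0_const R (fun u => L (x u) - d c * (u - c))).
    move: As dLx dcst; apply: filterS3 => u [_ [sxu _] _] dLu dcu.
    refine (is_derive_eq (derB (derComp dLu (smooth_at_is_derive sxu)) (derZ (d c) (derBc u c))) _).
    by rewrite -[X in X - _]/(d u) dcu mulr1 subrr.
  exists (d c); first exact: nbhs_singleton d2.
  move: Nx xM yphi; apply: filterS3 => u.
  rewrite subrr mulr0 subr0 xc0 L0 => /eqP; rewrite subr_eq0 => /eqP <- xu yu.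
  by rewrite /g xu -yu; exact: surjective_pairing.
Qed.

End Arcs.

(** * Comparison, uniqueness and extension of unit-speed arcs *)

Section ArcTheory.
Variable R : realType.
Implicit Types (S : set (R * R)) (p q w : R * R) (g : R -> R * R) (a b c d e u v : R).

Definition swap p := (p.2, p.1).

Lemma swapK : involutive swap.
Proof. by case. Qed.

Lemma swap_continuous p : {for p, continuous swap}.
Proof. by apply: pair_continuous; [exact: snd_continuous|exact: fst_continuous]. Qed.

Lemma arc_at_swap S g u : arc_at S (swap \o g) u <-> arc_at (swap @^-1` S) g u.
Proof.
by split=> -[Sg [g1 g2] v1]; split=> //; move: v1; rewrite /speed2 addrC.
Qed.

Lemma chart_swap S p g : local_chart (swap @^-1` S) (swap p) g ->
  local_chart S p (swap \o g).
Proof.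
move=> [g0 Ag cov uni]; split.
- by rewrite /= g0 swapK.
- by move: Ag; apply: filterS => u; rewrite arc_at_swap.
- move=> d d0; have := near_comp (@swap_continuous p) (cov d d0).
  apply: filterS => q /= Sq Sq'; have [|y yd gy] := Sq; first by rewrite swapK.
  by exists y => //; rewrite gy swapK.
- move=> s c sc As; have [||e e1 se] := uni (swap \o s) c.
  + by rewrite /= sc.
  + move: As; apply: filterS => u As; apply/arc_at_swap; move: As.
    by case=> Ss ? ?; split; rewrite //= swapK.
  + by exists e => //; move: se; apply: filterS => u /= <-; rewrite swapK.
Qed.

Definition locally_graph S := forall p, S p ->
  graph_at S p \/ graph_at (swap @^-1` S) (swap p).

Lemma locally_graph_chart S p : locally_graph S -> S p -> exists g, local_chart S p g.
Proof.
move=> SG Sp; have [/(graph_chart Sp)//|] := SG _ Sp.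
have Sp' : (swap @^-1` S) (swap p) by rewrite /= swapK.
by move=> /(graph_chart Sp')[g /chart_swap gS]; exists (swap \o g).
Qed.

Lemma affine_is_derive a b c u : is_derive u 1 (fun v => a + b * (v - c)) b.
Proof.
refine (is_derive_eq (derD (is_derive_cst a u 1) (derZ b (derBc u c))) _).
by rewrite add0r mulr1.
Qed.

Lemma affine_continuous a b c u : {for u, continuous (fun v => a + b * (v - c))}.
Proof. exact: is_derive_continuous (affine_is_derive a b c u). Qed.

Lemma affine_smooth a b c u : smooth_at (fun v => a + b * (v - c)) u.
Proof.
apply: (@smooth_atS _ _ (cst b)); last exact: smooth_at_cst.
by apply: filterE => v; exact: affine_is_derive.
Qed.

Lemma sqr_eq1 e : e ^+ 2 = 1 -> e = 1 \/ e = -1.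
Proof. by move/eqP; rewrite sqrf_eq1 => /orP[] /eqP; [left|right]. Qed.

Lemma derive1_affine (f : R -> R) a b c u : smooth_at f (a + b * (u - c)) ->
  (fun v => f (a + b * (v - c)))^`()%classic u = derive1 f (a + b * (u - c)) * b.
Proof.
move=> sf; apply: derive1_val.
exact: (@derComp _ f (fun v => a + b * (v - c)) _ _ _ (smooth_at_is_derive sf)
  (affine_is_derive a b c u)).
Qed.

Lemma arc_at_affine S g a e c u : e ^+ 2 = 1 -> arc_at S g (a + e * (u - c)) ->
  arc_at S (fun v => g (a + e * (v - c))) u.
Proof.
move=> e1 [Sg [g1 g2] v1]; split=> //.
  split.
    exact: (smooth_at_comp (f := fst \o g) (affine_smooth a e c u)).
  exact: (smooth_at_comp (f := snd \o g) (affine_smooth a e c u)).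
rewrite /speed2 (derive1_affine (f := fst \o g))// (derive1_affine (f := snd \o g))//.
by rewrite !exprMn e1 !mulr1.
Qed.

Lemma arc_at_near_eq S g g' u : (\forall v \near u, g v = g' v) ->
  arc_at S g u -> arc_at S g' u.
Proof.
move=> gg' [Sg [g1 g2] v1].
have gg1 : \forall v \near u, (fst \o g) v = (fst \o g') v.
  by move: gg'; apply: filterS => v /= ->.
have gg2 : \forall v \near u, (snd \o g) v = (snd \o g') v.
  by move: gg'; apply: filterS => v /= ->.
split.
- by rewrite -(nbhs_singleton gg').
- by split; [exact: smooth_at_eq g1|exact: smooth_at_eq g2].
- by rewrite /speed2 -(nbhs_singleton (near_eq_derive1 gg1))
    -(nbhs_singleton (near_eq_derive1 gg2)).
Qed.

Lemma arc_at_continuous S g u : arc_at S g u -> {for u, continuous g}.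
Proof. by case=> _ /vsmooth_continuous. Qed.

Section Unique.
Variable S : set (R * R).
Hypothesis SG : locally_graph S.

(** Both arcs are compared with one chart at the common point, and their signs relative to it
    multiply. *)
Lemma arc_compare g1 g2 c1 c2 : g1 c1 = g2 c2 ->
  (\forall u \near c1, arc_at S g1 u) -> (\forall u \near c2, arc_at S g2 u) ->
  exists2 e, e ^+ 2 = 1 & \forall u \near c1, g1 u = g2 (c2 + e * (u - c1)).
Proof.
move=> g12 A1 A2.
have Sp : S (g2 c2) by have [] := nbhs_singleton A2.
have [h [h0 _ _ uni]] := locally_graph_chart SG Sp.
have [e1 e11 E1] := uni _ _ g12 A1; have [e2 e21 E2] := uni _ _ erefl A2.
exists (e1 * e2); first by rewrite exprMn e11 e21 mulr1.
have c2E : c2 + e1 * e2 * (c1 - c1) = c2 by rewrite subrr mulr0 addr0.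
have := near_comp_at (@affine_continuous c2 (e1 * e2) c1 c1) c2E E2.
move: E1; apply: filterS2 => u -> ->; congr h.
by rewrite [c2 + _]addrC addrK mulrA mulrCA -expr2 e21 mulr1.
Qed.

(** The set where the germs agree is open. At a limit point of it positions and velocities agree by
    continuity, and [arc_compare] leaves only a sign; -1 would make the common velocity its own
    opposite, against unit speed. *)
Lemma arc_unique (I : set R) g1 g2 c : open I -> connected I -> I c ->
  (forall u, I u -> arc_at S g1 u) -> (forall u, I u -> arc_at S g2 u) ->
  (\forall u \near c, g1 u = g2 u) -> forall u, I u -> g1 u = g2 u.
Proof.
move=> oI cI Ic A1 A2 E.
pose B := [set u | I u /\ \forall v \near u, g1 v = g2 v].
suff -> : I = B by move=> u [_ /nbhs_singleton].
apply/esym/cI.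
- by exists c.
- exists [set u | \forall v \near u, g1 v = g2 v] => //.
  by rewrite openE => u /near_join.
- exists (closure B); first exact: closed_closure.
  apply/seteqP; split=> [u Bu|u [Iu clBu]]; first by split; [case: Bu|exact: subset_closure].
  split=> //.
  have nI : \forall v \near u, I v by exact: open_nbhs_nbhs.
  have A1u : \forall v \near u, arc_at S g1 v by move: nI; apply: filterS.
  have A2u : \forall v \near u, arc_at S g2 v by move: nI; apply: filterS.
  have near_eq (h1 h2 : R -> R) : {for u, continuous h1} -> {for u, continuous h2} ->
      (forall v, B v -> h1 v = h2 v) -> h1 u = h2 u.
    move=> hc1 hc2 hB; apply/eqP/negPn/negP; rewrite -subr_eq0 => hu.
    have hc : {for u, continuous (fun v => h1 v - h2 v)} by exact: continuousB.
    have [v [Bv]] := clBu _ (continuous_neq0 hc hu).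
    by rewrite /= hB// subrr eqxx.
  have [_ [s11 s12] v1] := A1 _ Iu; have [_ [s21 s22] v2] := A2 _ Iu.
  have Bfst v : B v -> \forall x \near v, (fst \o g1) x = (fst \o g2) x.
    by case=> _; apply: filterS => x /= ->.
  have Bsnd v : B v -> \forall x \near v, (snd \o g1) x = (snd \o g2) x.
    by case=> _; apply: filterS => x /= ->.
  have g12 : g1 u = g2 u.
    rewrite [LHS]surjective_pairing [RHS]surjective_pairing; congr pair.
      apply: (near_eq (fst \o g1) (fst \o g2)); try exact: smooth_at_continuous.
      by move=> v /Bfst/nbhs_singleton.
    apply: (near_eq (snd \o g1) (snd \o g2)); try exact: smooth_at_continuous.
    by move=> v /Bsnd/nbhs_singleton.
  have d1 : (fst \o g1)^`()%classic u = (fst \o g2)^`()%classic u.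
    apply: near_eq; try by apply: smooth_at_continuous; exact: smooth_at_derive1.
    by move=> v /Bfst/near_eq_derive1/nbhs_singleton.
  have d2 : (snd \o g1)^`()%classic u = (snd \o g2)^`()%classic u.
    apply: near_eq; try by apply: smooth_at_continuous; exact: smooth_at_derive1.
    by move=> v /Bsnd/near_eq_derive1/nbhs_singleton.
  have [e /sqr_eq1 [->|->] E12] := arc_compare g12 A1u A2u.
    by move: E12; apply: filterS => v ->; rewrite mul1r addrCA subrr addr0.
  have uE : u + -1 * (u - u) = u by rewrite subrr mulr0 addr0.
  have E1 : {near u, fst \o g1 =1 (fun v => (fst \o g2) (u + -1 * (v - u)))}.
    by move: E12; apply: filterS => v /= ->.
  have E2 : {near u, snd \o g1 =1 (fun v => (snd \o g2) (u + -1 * (v - u)))}.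
    by move: E12; apply: filterS => v /= ->.
  have := nbhs_singleton (near_eq_derive1 E1); have := nbhs_singleton (near_eq_derive1 E2).
  rewrite derive1_affine ?uE// derive1_affine ?uE// d1 d2 !mulrN1 => D2 D1.
  have D10 : (fst \o g2)^`()%classic u = 0 by lra.
  have D20 : (snd \o g2)^`()%classic u = 0 by lra.
  by move: v2; rewrite /speed2 D10 D20 !expr0n/= addr0 => /eqP; rewrite eq_sym oner_eq0.
Qed.

Definition arc_on a b g := forall u, a < u < b -> arc_at S g u.

Lemma arc_on_unique a b g1 g2 c : a < c < b -> arc_on a b g1 -> arc_on a b g2 ->
  (\forall u \near c, g1 u = g2 u) -> forall u, a < u < b -> g1 u = g2 u.
Proof.
move=> acb A1 A2 E u aub.
apply: (@arc_unique `]a, b[%classic g1 g2 c) => //=; rewrite ?in_itv//.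
by apply/connected_intervalP; exact: interval_is_interval.
Qed.

Definition garc g := forall u, arc_at S g u.

Lemma garc_compare g1 g2 c1 c2 : garc g1 -> garc g2 -> g1 c1 = g2 c2 ->
  exists2 e, e ^+ 2 = 1 & forall h, g1 (c1 + h) = g2 (c2 + e * h).
Proof.
move=> A1 A2 g12; have [||e e1 E] := arc_compare g12; [exact: filterE..|].
exists e => // h.
pose g3 u := g2 (c2 + e * (u - c1)).
rewrite (_ : h = c1 + h - c1); last by rewrite addrC addKr.
rewrite -[RHS]/(g3 _) [c1 + (_ - _)]addrC subrK.
apply: (@arc_unique setT g1 g3 c1) => //; first exact: openT.
  by apply/connected_intervalP => x y.
by move=> u _; exact: arc_at_affine.
Qed.

(** Any arc through [g c] is locally the chart, so it fills [S] there; this is what makes the ranges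
    of arcs relatively open. *)
Lemma garc_chart g c d : garc g -> 0 < d ->
  \forall q \near g c, S q -> exists2 y, `|y - c| < d & g y = q.
Proof.
move=> Ag d0; have Sp : S (g c) by case: (Ag c).
have [h [h0 hA cov uni]] := locally_graph_chart SG Sp.
have [|e e1 E] := uni g c erefl; first exact: filterE.
have [r /= r0 Er] := (nbhs_ballP _ _).1 E.
have := cov (Num.min r d); rewrite lt_min r0 d0 => /(_ isT).
apply: filterS => q /[apply] -[y]; rewrite lt_min => /andP[yr yd] hy.
have ne : `|e| = 1 by move: e1 => /sqr_eq1[->|->]; rewrite ?normrN normr1.
exists (c + e * y); first by rewrite addrAC subrr add0r normrM ne mul1r.
rewrite Er; last by rewrite /ball/= opprD addNKr normrN normrM ne mul1r.
by rewrite addrAC subrr add0r mulrA -expr2 e1 mul1r.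
Qed.

Lemma garc_loc_inj g c : garc g -> \forall u \near c, g u = g c -> u = c.
Proof.
move=> Ag.
have [_ [g1 g2] v1] := Ag c.
have inj (f : R -> R) : smooth_at f c -> f^`()%classic c != 0 ->
    \forall u \near c, f u = f c -> u = c.
  by move=> /smooth_at_is_derive; exact: derive_neq0_loc_inj.
have [D1|D1] := eqVneq ((fst \o g)^`()%classic c) 0; last first.
  by have := inj _ g1 D1; apply: filterS => u H gu; apply: H; rewrite /= gu.
have D2 : (snd \o g)^`()%classic c != 0.
  apply/eqP => D2; move: v1; rewrite /speed2 D1 D2 !expr0n/= addr0 => /eqP.
  by rewrite eq_sym oner_eq0.
by have := inj _ g2 D2; apply: filterS => u H gu; apply: H; rewrite /= gu.
Qed.

(** Recentred at [c], and up to a sign of its parameter, [h] agrees with [g] near [c], hence on the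
    whole overlap, which reaches up to [b]; past [b] it continues [g]. *)
Lemma arc_extend a b e g c h : a < c < b -> arc_on a b g ->
  arc_on (- e) e h -> 0 < e -> b <= c + e -> h 0 = g c ->
  exists2 g', arc_on a (c + e) g' & forall u, a < u < b -> g' u = g u.
Proof.
move=> acb Ag Ah e0 bce h0.
have Agc : \forall u \near c, arc_at S g u.
  have : \forall u \near c, u \in `]a, b[%R by apply: near_in_itvoo; rewrite in_itv.
  by apply: filterS => u; rewrite in_itv/= => /Ag.
have Ah0 : \forall u \near (0 : R), arc_at S h u.
  have : \forall u \near (0 : R), u \in `](- e), e[%R.
    by apply: near_in_itvoo; rewrite in_itv/= oppr_lt0 e0.
  by apply: filterS => u; rewrite in_itv/= => /Ah.
have [k k1 E] := arc_compare (esym h0) Agc Ah0.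
have nk : `|k| = 1 by move: k1 => /sqr_eq1[->|->]; rewrite ?normrN normr1.
pose h' u := h (0 + k * (u - c)).
have Ah' : arc_on (c - e) (c + e) h'.
  move=> u /andP[u1 u2]; apply: arc_at_affine => //; apply: Ah.
  rewrite add0r -ltr_norml normrM nk mul1r ltr_norml; apply/andP; split; lra.
pose a' := Num.max a (c - e).
have gh' u : a' < u < b -> g u = h' u.
  move: acb => /andP[ac cb].
  apply: (@arc_on_unique a' b g h' c) => //.
  - by rewrite cb andbT gt_max ac ltrBlDr ltrDl.
  - by move=> v /andP[]; rewrite gt_max => /andP[av _] vb; apply: Ag; rewrite av.
  - move=> v /andP[]; rewrite gt_max => /andP[_ av] vb; apply: Ah'; rewrite av/=.
    exact: lt_le_trans bce.
exists (fun u => if u < b then g u else h' u); last by move=> u /andP[_ ->].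
move=> u /andP[au uce]; have [ub|bu] := ltP u b.
  apply: (@arc_at_near_eq S g); last by apply: Ag; rewrite au.
  by move: (lt_nbhsl ub); apply: filterS => v ->.
apply: (@arc_at_near_eq S h'); last first.
  apply: Ah'; rewrite uce andbT; move: acb => /andP[ac cb]; lra.
have : \forall v \near u, a' < v.
  apply: lt_nbhsr; apply: lt_le_trans bu; move: acb => /andP[ac cb].
  by rewrite gt_max (lt_trans ac cb)/=; lra.
by apply: filterS => v a'v; case: ltP => // vb; rewrite gh'// a'v.
Qed.

End Unique.
End ArcTheory.

(** * Periods and complete arcs *)

Section Circle.
Variable R : realType.
Implicit Types (s t x : R) (k : int) (p q w : R * R).

Definition period : R := 2 * pi.

Lemma period_gt0 : 0 < period.
Proof. by rewrite mulr_gt0 ?pi_gt0. Qed.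

Lemma circleD_period s k : circle (s + k%:~R * period) = circle s.
Proof.
have circ_nat x n : circle (x + n%:R * period) = circle x.
  rewrite (_ : n%:R * period = pi *+ 2 *+ n); last first.
    by rewrite /period !mulr_natl.
  by rewrite /circle (periodicn (@cosD2pi R)) (periodicn (@sinD2pi R)).
case: k => n; first exact: circ_nat.
by rewrite NegzE mulrNz mulNr -pmulrn -[LHS](circ_nat _ n.+1) subrK.
Qed.

Lemma reduce_period s : exists k, 0 <= s + k%:~R * period < period.
Proof.
exists (- Num.floor (s / period)).
have /andP[f1 f2] := floor_itv (s / period).
rewrite ler_pdivlMr ?period_gt0// in f1; rewrite ltr_pdivrMr ?period_gt0// in f2.
rewrite mulrNz mulNr subr_ge0 f1 /= ltrBlDr.
by move: f2; rewrite intrD mulrDl mul1r addrC.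
Qed.

Lemma circle_eqP s t : circle s = circle t <-> exists k, s = t + k%:~R * period.
Proof.
split=> [[cst sst]|[k ->]]; last exact: circleD_period.
have [k /andP[k0 k1]] := reduce_period (s - t).
set x := s - t + _ in k0 k1.
have : circle x = circle (s - t) by exact: circleD_period.
case=> cx _.
have : cos x = 1.
  by rewrite cx cosB cst sst -!expr2 cos2Dsin2.
(* Half angle: [cos x = 1] forces [sin (x / 2) = 0], while [x / 2] lies in [[0, pi)]. *)
rewrite {1}(_ : x = (x / 2) *+ 2); last by rewrite -mulr_natr divfK.
rewrite cos_mulr2n cos2sin2 => E.
have sx : sin (x / 2) = 0.
  by apply/eqP; rewrite -sqrf_eq0; apply/eqP; lra.
have x0 : x = 0.
  apply/eqP; rewrite eq_le k0 andbT leNgt; apply/negP => xp.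
  have : 0 < sin (x / 2).
    apply: sin_gt0_pi; rewrite divr_gt0//= ltr_pdivrMr// mulrC; exact: k1.
  by rewrite sx ltxx.
exists (- k); rewrite mulrNz mulNr; move: x0; rewrite /x => /eqP.
by rewrite addr_eq0 => /eqP <-; rewrite addrC subrK.
Qed.

Definition lattice w := exists k l : int, w = (k%:~R * period, l%:~R * period).

Lemma latticeD w1 w2 : lattice w1 -> lattice w2 -> lattice (w1 + w2).
Proof.
by move=> [k1 [l1 ->]] [k2 [l2 ->]]; exists (k1 + k2), (l1 + l2); rewrite !intrD !mulrDl.
Qed.

Lemma latticeN w : lattice w -> lattice (- w).
Proof.
by move=> [k [l ->]]; exists (- k), (- l); rewrite !mulrNz !mulNr.
Qed.

Lemma torus_eqP p q : torus p = torus q <-> exists2 w, lattice w & p = q + w.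
Proof.
split=> [[c1 c2 c3 c4]|[w [k [l ->]] ->]]; last first.
  by rewrite /torus /= !circleD_period.
have [k kE] : exists k, p.1 = q.1 + k%:~R * period by apply/circle_eqP; congr pair.
have [l lE] : exists k, p.2 = q.2 + k%:~R * period by apply/circle_eqP; congr pair.
exists (k%:~R * period, l%:~R * period); first by exists k, l.
by rewrite [p]surjective_pairing kE lE.
Qed.

Lemma reduce_lattice p : exists2 w, lattice w &
  (p + w).1 \in `[0, period]%R /\ (p + w).2 \in `[0, period]%R.
Proof.
have [k /andP[k0 k1]] := reduce_period p.1; have [l /andP[l0 l1]] := reduce_period p.2.
exists (k%:~R * period, l%:~R * period); first by exists k, l.
by rewrite !in_itv/= k0 l0 !ltW.
Qed.

Lemma lattice_small w : lattice w -> `|w| < period -> w = 0.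
Proof.
have H k : `|k%:~R * period| < period -> k%:~R * period = 0.
  rewrite normrM (gtr0_norm period_gt0) gtr_pMl ?period_gt0// -intr_norm ltrz1.
  by rewrite -[_ < 1%Z]/(_ < 0 + 1) ltzD1 normr_le0 => /eqP ->; rewrite mul0r.
move=> [k [l ->]]; rewrite prod_normE/= gt_max => /andP[/H -> /H ->].
by [].
Qed.

End Circle.

Section Existence.
Variable R : realType.
Variable S : set (R * R).
Hypothesis SG : locally_graph S.
Hypothesis Scl : closed S.
Hypothesis Sper : forall p w, lattice w -> S p -> S (p + w).
Implicit Types (p q w : R * R) (g : R -> R * R) (a b c d e u v : R).

Lemma arc_at_translate g w u : lattice w -> arc_at S g u ->
  arc_at S (fun v => g v + w) u.
Proof.
move=> lw [Sg [g1 g2] v1].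
have sm (f : R -> R) c : smooth_at f u -> smooth_at (fun v => f v + c) u.
  by move=> sf; apply: smooth_atD => //; exact: smooth_at_cst.
have de (f : R -> R) c : smooth_at f u -> (fun v => f v + c)^`()%classic u = derive1 f u.
  move=> sf; apply: derive1_val.
  by rewrite -[derive1 f u]addr0; exact: derD (smooth_at_is_derive sf) (is_derive_cst c u 1).
split; first exact: Sper.
  by split; exact: sm.
by rewrite /speed2 (de (fst \o g))// (de (snd \o g)).
Qed.

(** Compactness of the part of [S] in one period square makes the length uniform: a chart defined up
    to [r] provides an arc of length [r / 2] on either side of each point that it reaches before
    [r / 2]. *)
Lemma uniform_arc : exists2 e, 0 < e & forall p, S p ->
  exists2 g, g 0 = p & arc_on S (- e) e g.
Proof.
pose K := S `&` (`[0, period R]%classic `*` `[0, period R]%classic).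
have cK : compact K.
  rewrite /K setIC; apply: compact_closedI => //.
  by apply: compact_setX; exact: segment_compact.
pose P e p := S p -> exists2 g, g 0 = p & arc_on S (- e) e g.
have := (compact_near_coveringP K).1 cK R (0^'+) P _.
case=> [p [Sp _]|e /= e0 He].
  have [g [g0 Ag cov _]] := locally_graph_chart SG Sp.
  have [r /= r0 Ar] := (nbhs_ballP _ _).1 Ag.
  have r20 : 0 < r / 2 by rewrite divr_gt0.
  exists ([set q | S q -> exists2 y, `|y| < r / 2 & g y = q], [set e | e < r / 2]).
    by split; [exact: cov|exact: nbhs_right_lt].
  move=> [q e] /= [Hq er] /Hq[y yr gy].
  exists (fun u => g (y + 1 * (u - 0))); first by rewrite subr0 mulr0 addr0.
  move=> u /andP[u1 u2]; apply: arc_at_affine; first exact: expr1n.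
  apply: Ar; rewrite /ball/= sub0r normrN subr0 mul1r.
  move: yr; rewrite !ltr_norml => /andP[? ?]; apply/andP; split; lra.
have e20 : 0 < e / 2 by rewrite divr_gt0.
exists (e / 2) => // p Sp.
have [w lw [w1 w2]] := reduce_lattice p.
have be : ball_ Num.norm 0 e (e / 2).
  by rewrite /= sub0r normrN gtr0_norm// ltr_pdivrMr// ltr_pMr// ltr1n.
have Spw : S (p + w) by exact: Sper.
have [//|g g0 Ag] := He _ be e20 (p + w) _ Spw.
exists (fun u => g u - w); first by rewrite g0 addrK.
by move=> u /Ag; apply: arc_at_translate; exact: latticeN.
Qed.

Lemma arc_reflect a b g : arc_on S a b g -> arc_on S (- b) (- a) (fun u => g (- u)).
Proof.
move=> Ag u /andP[u1 u2].
have -> : (fun u => g (- u)) = (fun u => g (0 + -1 * (u - 0))).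
  by apply/funext => v; rewrite add0r subr0 mulN1r.
apply: arc_at_affine; first by rewrite sqrrN expr1n.
by apply: Ag; rewrite add0r subr0 mulN1r; apply/andP; split; lra.
Qed.

Lemma garc_exists p : S p -> exists2 g, garc S g & g 0 = p.
Proof.
move=> Sp; have [e e0 He] := uniform_arc.
have [h h0 Ah] := He _ Sp.
have ext r g : e <= r -> arc_on S (- r) r g ->
    exists2 g', arc_on S (- (r + e / 2)) (r + e / 2) g' &
      forall u, - r < u < r -> g' u = g u.
  move=> er Ag.
  have right s g1 : r <= s -> arc_on S (- s) r g1 ->
      exists2 g', arc_on S (- s) (r + e / 2) g' & forall u, - s < u < r -> g' u = g1 u.
    move=> rs Ag1.
    (* The added arc is centred here, inside the domain; with half-length [e] it overshoots [r] by
       [e / 2]. *)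
    have cin : - s < r - e / 2 < r by apply/andP; split; lra.
    have [k k0 Ak] : exists2 k, k 0 = g1 (r - e / 2) & arc_on S (- e) e k.
      by apply: He; have [] := Ag1 _ cin.
    rewrite (_ : r + e / 2 = r - e / 2 + e); last by lra.
    by apply: arc_extend Ak _ _ _ => //; lra.
  have [g1 Ag1 E1] := right r g (lexx r) Ag.
  (* The left end becomes the right end of the reflected arc. *)
  have Ag1' := arc_reflect Ag1; rewrite opprK in Ag1'.
  have [|g2 Ag2 E2] := right (r + e / 2) _ _ Ag1'; first by lra.
  exists (fun u => g2 (- u)).
    by have := arc_reflect Ag2; rewrite opprK.
  move=> u /andP[u1 u2]; rewrite E2; last by apply/andP; split; lra.
  by rewrite opprK E1// u1.
pose r (n : nat) := e + n%:R * (e / 2).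
have re n : e <= r n by rewrite lerDl mulr_ge0// ltW// divr_gt0.
have all_ext n : exists g, arc_on S (- r n) (r n) g /\ forall u, - e < u < e -> g u = h u.
  elim: n => [|n [g [Ag gh]]]; first by exists h; rewrite /r mul0r addr0.
  have [g' Ag' g'g] := ext _ _ (re n) Ag.
  exists g'; split=> [|u /andP[u1 u2]].
    by rewrite (_ : r n.+1 = r n + e / 2)// /r mulrS mulrDl mul1r; lra.
  rewrite g'g ?gh ?u1//; have := re n; move=> ?; apply/andP; split; lra.
have [G HG] := choice all_ext.
have rmono m n : (m <= n)%N -> r m <= r n.
  by move=> mn; rewrite lerD2l ler_wpM2r ?ler_nat// ltW// divr_gt0.
(* The chosen arcs were not picked as extensions of one another, but all coincide with [h] on
   [(-e, e)]; uniqueness makes them agree wherever both are defined. *)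
have GE m n u : (m <= n)%N -> - r m < u < r m -> G m u = G n u.
  move=> mn um; have [Am hm] := HG m; have [An hn] := HG n.
  apply: (@arc_on_unique _ S SG (- r m) (r m) (G m) (G n) 0) => //.
  - by rewrite oppr_lt0 (lt_le_trans e0 (re m)).
  - by move=> v /andP[v1 v2]; apply: An; have := rmono _ _ mn => ?; apply/andP; split; lra.
  - have : \forall u \near (0 : R), u \in `](- e), e[%R.
      by apply: near_in_itvoo; rewrite in_itv/= oppr_lt0 e0.
    by apply: filterS => v; rewrite in_itv/= => ve; rewrite hm ?hn.
have bnd u : exists n, `|u| < r n.
  exists (Num.bound (`|u| / (e / 2))).
  have : `|u| / (e / 2) < (Num.bound (`|u| / (e / 2)))%:R.
    by apply: archi_boundP; rewrite divr_ge0// ltW// divr_gt0.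
  by rewrite ltr_pdivrMr ?divr_gt0// => /lt_le_trans; apply; rewrite lerDr ltW.
have [N HN] := choice bnd.
pose g u := G (N u) u.
have gE n u : `|u| < r n -> g u = G n u.
  move=> un; rewrite /g; have [Nn|/ltnW nN] := leqP (N u) n.
    by apply: GE => //; rewrite -ltr_norml.
  by apply/esym/GE => //; rewrite -ltr_norml.
exists g; last first.
  by rewrite (gE 0%N) ?normr0 ?(lt_le_trans e0 (re _))// (HG 0%N).2 ?oppr_lt0 ?e0.
move=> u; apply: (@arc_at_near_eq _ S (G (N u))); last first.
  by apply: (HG _).1; rewrite -ltr_norml.
have : \forall v \near u, v \in `](- r (N u)), (r (N u))[%R.
  by apply: near_in_itvoo; rewrite in_itv/= -ltr_norml.
by apply: filterS => v; rewrite in_itv/= -ltr_norml => /gE.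
Qed.

End Existence.

(** * Components on the torus *)

Section Torus.
Variable R : realType.
Implicit Types (s t x e : R) (p q w : R * R).

Lemma circle_continuous s : {for s, continuous (@circle R)}.
Proof. by apply: pair_continuous; [exact: continuous_cos|exact: continuous_sin]. Qed.

Lemma torus_continuous p : {for p, continuous (@torus R)}.
Proof.
apply: (pair_continuous (f := circle \o fst) (g := circle \o snd)).
  by apply: continuous_comp; [exact: fst_continuous|exact: circle_continuous].
by apply: continuous_comp; [exact: snd_continuous|exact: circle_continuous].
Qed.

Lemma cos_gt_near x e : 0 < e <= pi -> cos e < cos x ->
  exists k : int, `|x + k%:~R * period R| < e.
Proof.
move=> /andP[e0 epi] ex.
have [k /andP[k0 k1]] := reduce_period x.
have cxk : cos (x + k%:~R * period R) = cos x.
  by have [] := circleD_period x k.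
set y := x + _ in k0 k1 cxk.
have [ypi|piy] := leP y pi.
  exists k; rewrite -/y ger0_norm// -(@ltr_cos R) ?in_itv/= ?k0 ?ypi ?(ltW e0) ?epi//.
  by rewrite cxk.
exists (k - 1); rewrite intrB mulrBl mul1r addrA -/y.
rewrite distrC ger0_norm; last by rewrite subr_ge0 ltW.
rewrite -(@ltr_cos R) ?in_itv/= ?(ltW e0) ?epi ?subr_ge0 ?(ltW k1)//; last first.
  by rewrite /period; lra.
rewrite cosB /period.
have [-> ->] : cos (2 * pi) = 1 :> R /\ sin (2 * pi) = 0 :> R.
  by rewrite mulr_natl cos2pi sin2pi.
by rewrite mul1r mul0r addr0 cxk.
Qed.

Lemma circle_open s e : 0 < e -> \forall z \near circle s, forall t, circle t = z ->
  exists k : int, `|t + k%:~R * period R - s| < e.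
Proof.
move=> e0; pose d := Num.min e pi.
have d0 : 0 < d <= pi by rewrite lt_min e0 pi_gt0 ge_min lexx orbT.
(* The scalar product with [circle s]: at [circle t] it equals [cos (t - s)], so [cos d < F z]
   controls every lift [t] of [z], not only one near [s]. *)
pose F (z : R * R) := z.1 * cos s + z.2 * sin s.
have Fc : {for circle s, continuous F}.
  apply: continuousD; apply: continuousM; try exact: cst_continuous.
    exact: fst_continuous.
  exact: snd_continuous.
have Fs : cos d < F (circle s).
  rewrite /F/= -!expr2 cos2Dsin2 -cos0 ltr_cos ?in_itv/=; case/andP: (d0) => // ? ?.
  - by rewrite lexx pi_ge0.
  - by apply/andP; split=> //; exact: ltW.
have : \forall z \near circle s, cos d < F z by exact: (cvgr_gt _ Fc).
apply: filterS => z Fz t tz.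
have [|k kd] := cos_gt_near (x := t - s) d0.
  by rewrite cosB; move: Fz; rewrite -tz.
exists k; rewrite addrAC; apply: lt_le_trans kd _.
by rewrite ge_min lexx.
Qed.

(** Openness of the quotient map in terms of lifts: every lift of a point near [torus p] can be
    moved near [p] by the lattice. *)
Lemma torus_open p (P : R * R -> Prop) : (\forall q \near p, P q) ->
  \forall z \near torus p, forall q, torus q = z -> exists2 w, lattice w & P (q + w).
Proof.
move=> /nbhs_ballP[e /= e0 He].
have fc : {for torus p, continuous fst} by exact: cvg_fst.
have sc : {for torus p, continuous snd} by exact: cvg_snd.
have n1 := near_comp_at fc erefl (circle_open p.1 e0).
have n2 := near_comp_at sc erefl (circle_open p.2 e0).
move: n1 n2; apply: filterS2 => z H1 H2 q qz.
have [k kE] := H1 q.1 (congr1 fst qz); have [l lE] := H2 q.2 (congr1 snd qz).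
exists (k%:~R * period R, l%:~R * period R); first by exists k, l.
by apply: He; split; rewrite /ball/= distrC.
Qed.

Lemma discrete_subgroup (P : set R) e : (forall x y, P x -> P y -> P (x - y)) ->
  0 < e -> (forall x, P x -> `|x| < e -> x = 0) -> (exists2 x, P x & x != 0) ->
  exists2 T : R, 0 < T & forall x, P x <-> exists k : int, x = k%:~R * T.
Proof.
move=> PB e0 Pe [x0 Px0 x00].
have P0 : P 0 by rewrite -(subrr x0); exact: PB.
have PN x : P x -> P (- x) by move=> Px; rewrite -sub0r; exact: PB.
have PD x y : P x -> P y -> P (x + y).
  by move=> Px Py; rewrite -[y]opprK; apply: PB => //; exact: PN.
pose X : set R := [set x | 0 < x /\ P x].
have X0 : X `|x0|.
  split; first by rewrite normr_gt0.
  by have [] := ger0P x0 => // _; exact: PN.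
have Xinf : has_inf X by split; [exists (`|x0|)|exists 0 => x [/ltW]].
(* An element within [e] of the infimum is the minimum: a smaller positive one would differ from it
   by less than [e]. *)
have [T [T0 PT] Tm] := inf_adherent e0 Xinf.
have Tmin x : P x -> 0 < x -> T <= x.
  move=> Px xp; rewrite leNgt; apply/negP => xT.
  have mx : inf X <= x by apply: ge_inf => //; exact: Xinf.2.
  have : T - x = 0.
    apply: Pe; first exact: PB.
    by rewrite ger0_norm ?subr_ge0 ?ltW//; lra.
  by move/eqP; rewrite subr_eq0 gt_eqF.
have Pn (n : nat) : P (n%:R * T).
  by elim: n => [|n IH]; rewrite ?mul0r// mulrS mulrDl mul1r; exact: PD.
have Pk (k : int) : P (k%:~R * T).
  by case: k => n; [exact: Pn|rewrite NegzE mulrNz mulNr; apply: PN; exact: Pn].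
exists T => // x; split=> [Px|[k ->]]; last exact: Pk.
exists (Num.floor (x / T)); apply/eqP; rewrite -subr_eq0; apply/eqP.
have /andP[f1 f2] := floor_itv (x / T).
rewrite ler_pdivlMr// in f1; rewrite ltr_pdivrMr// intrD mulrDl mul1r in f2.
apply/eqP; rewrite eq_le subr_ge0 f1 andbT leNgt; apply/negP => xp.
have := Tmin _ (PB _ _ Px (Pk (Num.floor (x / T)))) xp.
by rewrite leNgt ltrBlDr addrC f2.
Qed.

End Torus.

Section Classification.
Variable R : realType.
Variable S : set (R * R).
Hypothesis SG : locally_graph S.
Hypothesis Scl : closed S.
Hypothesis Sper : forall p w, lattice w -> S p -> S (p + w).
Implicit Types (p q w : R * R) (g h : R -> R * R) (a b c d e u v x y : R).

Lemma torus_mem q : (torus @` S) (torus q) -> S q.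
Proof.
move=> [p Sp] /torus_eqP[w lw pq]; rewrite -(addrK w q) -pq.
by apply: Sper => //; exact: latticeN.
Qed.

Lemma torus_compact : compact (torus @` S).
Proof.
pose K := S `&` (`[0, period R]%classic `*` `[0, period R]%classic).
have cK : compact K.
  rewrite /K setIC; apply: compact_closedI => //.
  by apply: compact_setX; exact: segment_compact.
rewrite (_ : torus @` S = torus @` K).
  apply: continuous_compact => //; apply: continuous_subspaceT => p.
  exact: torus_continuous.
apply/seteqP; split=> z [p]; last by move=> [Sp _ <-]; exists p.
move=> Sp <-; have [w lw [w1 w2]] := reduce_lattice p.
exists (p + w); first by split; [exact: Sper|].
by apply/torus_eqP; exists w.
Qed.

Lemma torus_closed : closed (torus @` S).
Proof. by apply: compact_closed torus_compact; exact: norm_hausdorff. Qed.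

Lemma garc_cover g c d : garc S g -> 0 < d ->
  \forall z \near torus (g c), (torus @` S) z ->
    exists2 y, `|y - c| < d & torus (g y) = z.
Proof.
move=> Ag d0; have := torus_open (garc_chart SG c Ag d0).
apply: filterS => z Hz [q Sq qz]; have [w lw] := Hz _ qz.
case=> [|y yd gy]; first exact: Sper.
by exists y => //; rewrite -qz gy; apply/torus_eqP; exists w.
Qed.

Lemma garc_translate g w : lattice w -> garc S g -> garc S (fun u => g u + w).
Proof. by move=> lw Ag u; exact: arc_at_translate. Qed.

Lemma garc_merge g h x y : garc S g -> garc S h -> torus (g x) = torus (h y) ->
  range (torus \o h) `<=` range (torus \o g).
Proof.
move=> Ag Ah /torus_eqP[w lw gh] z [v _ <-].
have [e e1 E] := garc_compare SG Ag (garc_translate lw Ah) gh.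
exists (x + e * (v - y)) => //=; rewrite E mulrA -expr2 e1 mul1r [y + _]addrC subrK.
by apply/torus_eqP; exists w.
Qed.

(** A complete arc [h] through the limit point covers [S] nearby, so it meets [g] modulo the
    lattice; then [garc_merge] puts all of [h], and the limit point with it, on [g]. *)
Lemma garc_range_closed g : garc S g -> closed (range (torus \o g)).
Proof.
move=> Ag z clz.
have Sz : (torus @` S) z.
  apply: torus_closed; apply: closureS clz => _ [u _ <-].
  by exists (g u) => //; case: (Ag u).
case: Sz => q Sq qz; have [h Ah h0] := garc_exists SG Scl Sper Sq.
have := garc_cover 0 Ah ltr01; rewrite h0 qz => /clz[_ [[u _ <-] H]].
have [|y _ hy] := H; first by exists (g u) => //; case: (Ag u).
apply: (garc_merge Ag Ah (esym hy)).
by exists 0 => //=; rewrite h0.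
Qed.

(** Being connected, the range lies in the component; being open and closed in the image of [S], it
    exhausts it. *)
Lemma component_range g : garc S g ->
  connected_component (torus @` S) (torus (g 0)) = range (torus \o g).
Proof.
move=> Ag; set C := connected_component _ _.
have BS : range (torus \o g) `<=` torus @` S.
  by move=> _ [u _ <-]; exists (g u) => //; case: (Ag u).
have BC : range (torus \o g) `<=` C.
  apply: connected_component_max => //.
  apply: connected_continuous_connected; first by apply/connected_intervalP => x y.
  apply: continuous_subspaceT => u.
  apply: continuous_comp; first exact: arc_at_continuous (Ag u).
  exact: torus_continuous.
apply/esym/(@component_connected _ (torus @` S) (torus (g 0))).
- by exists (torus (g 0)); exists 0.
- exists [set z | \forall z' \near z, (torus @` S) z' -> range (torus \o g) z'].
    by rewrite openE => z /near_join.
  apply/seteqP; split=> z; last first.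
    by move=> [/connected_component_sub Sz /nbhs_singleton]; apply.
  move=> gz; split; first exact: BC.
  case: gz => c _ <-; have := garc_cover c Ag ltr01.
  by apply: filterS => z' H /H[y _ <-]; exists y.
- exists (range (torus \o g)); first exact: garc_range_closed.
  by apply/esym/setIidPr.
Qed.

(** By compactness the points at integer times accumulate at some [torus (g c)]. Times beyond
    [c + 1] therefore come back near it, where times within 1 of [c] already cover everything. *)
Lemma garc_noninjective g : garc S g -> exists x y, x != y /\ torus (g x) = torus (g y).
Proof.
move=> Ag.
pose B := range (torus \o g).
have cB : compact B.
  rewrite (_ : B = torus @` S `&` B); last first.
    by apply/esym/setIidPr => _ [u _ <-]; exists (g u) => //; case: (Ag u).
  by apply: compact_closedI; [exact: torus_compact|exact: garc_range_closed].
pose F : set_system _ := (fun n : nat => torus (g n%:R)) @ \oo.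
have FB : F B by exists 0%N => // n _; exists n%:R.
have [z [[c _ <-] clz]] := cB F _ FB.
have /= := clz [set z | exists2 x, c + 1 < x & torus (g x) = z].
have HF : F [set z | exists2 x, c + 1 < x & torus (g x) = z].
  exists (Num.bound `|c + 1|) => // n /= bn; exists n%:R => //.
  have : `|c + 1| < (Num.bound `|c + 1|)%:R by exact: archi_boundP.
  move=> cb; apply: le_lt_trans (ler_norm _) _; apply: lt_le_trans cb _.
  by rewrite ler_nat.
move=> /(_ _ HF (garc_cover c Ag ltr01))[_ [[x cx <-] H]].
have [|y yc gy] := H; first by exists (g x) => //; case: (Ag x).
exists x, y; split; last by rewrite gy.
rewrite gt_eqF//; move: yc; rewrite ltr_norml => /andP[_]; lra.
Qed.

Definition translation_period g (T : R) := exists2 w, lattice w & forall h : R, g (h + T) = g h + w.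

Lemma translation_periodP g x y : garc S g ->
  torus (g x) = torus (g y) <-> translation_period g (x - y).
Proof.
move=> Ag; split=> [/torus_eqP[w lw gxy]|[w lw gw]]; last first.
  by apply/torus_eqP; exists w => //; rewrite -gw addrC subrK.
have [e e1 E] := garc_compare SG Ag (garc_translate lw Ag) gxy.
exists w => // h; case: (sqr_eq1 e1) => e1E; move: E; rewrite e1E => E.
  by have := E (h - y); rewrite mul1r [y + _]addrC subrK => <-; congr g; ring.
(* Under a reversal, [h = (y - x) / 2] puts both sides at the midpoint, so the lattice vector
   vanishes. *)
have w0 : w = 0.
  have := E ((y - x) / 2); rewrite (_ : x + _ = (x + y) / 2); last by lra.
  rewrite (_ : y + _ = (x + y) / 2); last by lra.
  by move=> /eqP; rewrite -subr_eq0 opprD addrA subrr sub0r oppr_eq0 => /eqP.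
(* A reversal of orientation would fix [m], where the velocity would vanish. *)
exfalso; pose m := (x + y) / 2.
have gsym u : g u = g (m + -1 * (u - m)).
  have := E (u - x); rewrite w0 addr0 [x + _]addrC subrK => ->; congr g.
  by rewrite /m; lra.
have [_ [g1 g2] v1] := Ag m.
have mE : m + -1 * (m - m) = m by rewrite subrr mulr0 addr0.
have D (f : R -> R) : smooth_at f m -> (forall u, f u = f (m + -1 * (u - m))) ->
    f^`()%classic m = 0.
  move=> sf fE.
  have := derive1_affine (f := f) (a := m) (b := -1) (c := m) (u := m).
  rewrite mE => /(_ sf); rewrite (_ : (fun v => f (m + -1 * (v - m))) = f); first by lra.
  by apply/funext => u; rewrite -fE.
move: v1; rewrite /speed2 !D// ?expr0n/= ?addr0; first by move/eqP; rewrite eq_sym oner_eq0.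
- by move=> u /=; rewrite -gsym.
- by move=> u /=; rewrite -gsym.
Qed.

Definition garc_has_period g (T : R) :=
  forall x y : R, torus (g x) = torus (g y) <-> exists k : int, x - y = k%:~R * T.

(** The translation periods form a subgroup of the line. It is discrete: a small period displaces
    [g 0] by a short lattice vector, hence by 0, and [g] does not return to [g 0] at small nonzero
    times. It is nontrivial by [garc_noninjective]. *)
Lemma garc_period g : garc S g -> exists2 T, 0 < T & garc_has_period g T.
Proof.
move=> Ag.
have [|d /= d0 Hd] := (nbhs_ballP (0 : R)
    (fun u => `|g 0 - g u| < period R /\ (g u = g 0 -> u = 0))).1.
  apply: filterI; last exact: garc_loc_inj.
  have gc := arc_at_continuous (Ag 0).
  by move/cvgrPdist_lt: gc => /(_ _ (period_gt0 R)).
have [x y Px Py|x Px xd||T T0 HT] := @discrete_subgroup _ (translation_period g) d _ d0.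
- have [w lw Hw] := Px; have [w' lw' Hw'] := Py; exists (w - w').
    by apply: latticeD => //; exact: latticeN.
  move=> h; have E1 := Hw (h - y); have E2 := Hw' (h - y); rewrite subrK in E2.
  rewrite (_ : h + (x - y) = h - y + x); last by ring.
  by rewrite E1 E2 -addrA [w' + _]addrC subrK.
- have [w lw Hw] := Px; have := Hw 0; rewrite add0r => gx.
  have [] : `|g 0 - g x| < period R /\ (g x = g 0 -> x = 0).
    by apply: Hd; rewrite /ball/= sub0r normrN.
  rewrite {1}gx opprD addNKr normrN => wp; apply; rewrite gx.
  by rewrite (lattice_small lw wp) addr0.
- have [x [y [xy gxy]]] := garc_noninjective Ag.
  by exists (x - y); [exact/translation_periodP|rewrite subr_eq0].
- exists T => // x y; rewrite translation_periodP//; exact: HT.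
Qed.

Lemma garc_scale_smooth g (c : R) u : garc S g -> vsmooth_at (fun v => g (c * v)) u.
Proof.
move=> Ag; have [_ [g1 g2] _] := Ag (c * u).
have cE v : c * v = 0 + c * (v - 0) by rewrite subr0 add0r.
rewrite cE in g1 g2.
have -> : (fun v => g (c * v)) = (fun v => g (0 + c * (v - 0))).
  by apply/funext => v; rewrite cE.
split.
  exact: (smooth_at_comp (f := fst \o g) (affine_smooth 0 c 0 u)).
exact: (smooth_at_comp (f := snd \o g) (affine_smooth 0 c 0 u)).
Qed.

Lemma garc_closed_parameterization g T : garc S g -> 0 < T -> garc_has_period g T ->
  closed_parameterization (range (torus \o g)) (fun u => g (T / period R * u)).
Proof.
move=> Ag T0 HT.
pose c := T / period R.
have P0 := period_gt0 R.
have c0 : 0 < c by rewrite divr_gt0.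
have cE u : c * u = 0 + c * (u - 0) by rewrite subr0 add0r.
have sm u := garc_scale_smooth c u Ag.
split.
- by apply/vsmoothP => u; exact: sm.
- move=> u; rewrite (vsmooth_derive1 (sm u)) => -[].
  have [_ [g1 g2] v1] := Ag (c * u); rewrite cE in g1 g2.
  have -> : fst \o (fun v => g (c * v)) = (fun v => (fst \o g) (0 + c * (v - 0))).
    by apply/funext => v /=; rewrite cE.
  have -> : snd \o (fun v => g (c * v)) = (fun v => (snd \o g) (0 + c * (v - 0))).
    by apply/funext => v /=; rewrite cE.
  rewrite !derive1_affine// -cE => /eqP; rewrite mulf_eq0 (gt_eqF c0) orbF => /eqP D1.
  move=> /eqP; rewrite mulf_eq0 (gt_eqF c0) orbF => /eqP D2.
  by move: v1; rewrite /speed2 D1 D2 expr0n/= addr0 => /eqP; rewrite eq_sym oner_eq0.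
- move=> u v; rewrite circle_eqP HT.
  have cP : c * period R = T by rewrite /c divfK// gt_eqF.
  split=> -[k]; rewrite -mulrBr => E; exists k.
    apply/eqP; rewrite addrC -subr_eq; apply/eqP.
    by apply: (mulfI (lt0r_neq0 c0)); rewrite E mulrCA cP.
  by rewrite E addrAC subrr add0r mulrCA cP.
- apply/seteqP; split=> z [u _ <-]; first by exists (T / period R * u).
  exists (u / c) => //=; rewrite -/c mulrCA divff ?mulr1//.
  by rewrite gt_eqF.
Qed.

End Classification.

Lemma derive1n_periodic (R : realType) (V : normedModType R) (f : R -> V) (T : R) n :
  (forall s, f (s + T) = f s) -> forall s, f^`(n) (s + T) = f^`(n) s.
Proof.
move=> fT; elim: n => [//|n IH] s; rewrite !derive1nS /derive1.
congr (lim (_ @ 0^')); apply/funext => h.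
by rewrite addrA !IH.
Qed.

Lemma proportional_slope (R : realType) (a b x1 y1 x2 y2 : R) :
  a ^+ 2 + b ^+ 2 != 0 -> a * x1 + b * y1 != 0 -> a * x2 + b * y2 != 0 ->
  x1 * y2 - y1 * x2 = 0 <->
  (a * y1 - b * x1) / (a * x1 + b * y1) = (a * y2 - b * x2) / (a * x2 + b * y2).
Proof.
move=> e0 es et; split=> [D0|/eqP].
  apply/eqP; rewrite eqr_div// -subr_eq0.
  rewrite (_ : _ - _ = - (a ^+ 2 + b ^+ 2) * (x1 * y2 - y1 * x2)); last by ring.
  by rewrite D0 mulr0.
rewrite eqr_div// -subr_eq0.
rewrite (_ : _ - _ = - (a ^+ 2 + b ^+ 2) * (x1 * y2 - y1 * x2)); last by ring.
by rewrite mulf_eq0 oppr_eq0 (negbTE e0)/= => /eqP.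
Qed.

(** * The parallel pairs of a generic curve *)

Section Curve.
Variables (R : realType) (f : R -> R * R).
Hypothesis f_curve : closed_regular_curve f.
Hypothesis f_generic : generic f.
Implicit Types (s t : R) (p q w e : R * R).

Definition xder n s : R := (f^`(n) s).1.
Definition yder n s : R := (f^`(n) s).2.
Local Notation X := xder.
Local Notation Y := yder.

Definition velocity_det s t : R := X 1 s * Y 1 t - Y 1 s * X 1 t.
Local Notation D := velocity_det.

(** The numerator of the signed curvature, with the same sign and zeros. *)
Definition acceleration_det s : R := X 1 s * Y 2 s - Y 1 s * X 2 s.
Local Notation K := acceleration_det.

Lemma D_det2 s t : det2 (f^`() s) (f^`() t) = D s t.
Proof. by []. Qed.

Lemma K_det2 s : det2 (f^`() s) (f^`(2) s) = K s.
Proof. by []. Qed.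

Lemma fsmooth n s : vsmooth_at (f^`(n)) s.
Proof.
move: s; apply/vsmoothP; have [sf _ _] := f_curve.
by move=> k x; rewrite /derive1n -iterD; exact: sf.
Qed.

Lemma fder_period n s (k : int) : f^`(n) (s + k%:~R * period R) = f^`(n) s.
Proof.
have [_ fP _] := f_curve.
have nat_period (m : nat) x : f^`(n) (x + m%:R * period R) = f^`(n) x.
  elim: m => [|m IH]; first by rewrite mul0r addr0.
  by rewrite -natr1 mulrDl mul1r addrA derive1n_periodic.
case: k => m; first exact: nat_period.
by rewrite NegzE mulrNz mulNr -pmulrn -[LHS](nat_period m.+1) subrK.
Qed.

Lemma fder_circle n s t : circle s = circle t -> f^`(n) s = f^`(n) t.
Proof. by move=> /circle_eqP[k ->]; exact: fder_period. Qed.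

Lemma X_smooth n s : smooth_at (X n) s.
Proof. by case: (fsmooth n s). Qed.

Lemma Y_smooth n s : smooth_at (Y n) s.
Proof. by case: (fsmooth n s). Qed.

Lemma X_derive n s : is_derive s 1 (X n) (X n.+1 s).
Proof.
have := vsmooth_is_derive (fsmooth n s); rewrite -(vsmooth_derive1 (fsmooth n s)).
by move=> /is_derive_pair[].
Qed.

Lemma Y_derive n s : is_derive s 1 (Y n) (Y n.+1 s).
Proof.
have := vsmooth_is_derive (fsmooth n s); rewrite -(vsmooth_derive1 (fsmooth n s)).
by move=> /is_derive_pair[].
Qed.

Lemma X_circle n s t : circle s = circle t -> X n s = X n t.
Proof. by move=> st; rewrite /xder (fder_circle n st). Qed.

Lemma Y_circle n s t : circle s = circle t -> Y n s = Y n t.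
Proof. by move=> st; rewrite /yder (fder_circle n st). Qed.

Lemma K_smooth s : smooth_at K s.
Proof.
apply: (smooth_atD (f := X 1 \* Y 2) (g := fun u => - (Y 1 \* X 2) u)).
  exact: smooth_atM (X_smooth 1 s) (Y_smooth 2 s).
exact: smooth_atN (smooth_atM (Y_smooth 1 s) (X_smooth 2 s)).
Qed.

Lemma K_derive s : is_derive s 1 K (X 1 s * Y 3 s - Y 1 s * X 3 s).
Proof.
have d1 := derM (X_derive 1 s) (Y_derive 2 s).
have d2 := derM (Y_derive 1 s) (X_derive 2 s).
refine (is_derive_eq (derB d1 d2) _).
move: (X 1 s) (Y 1 s) (X 2 s) (Y 2 s) (X 3 s) (Y 3 s) => x1 y1 x2 y2 x3 y3; ring.
Qed.

Lemma fregular s : X 1 s != 0 \/ Y 1 s != 0.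
Proof.
have [X0|] := eqVneq (X 1 s) 0; last by left.
have [Y0|] := eqVneq (Y 1 s) 0; last by right.
exfalso; apply: (generic_regular f_generic (s := s)).
by rewrite [LHS]surjective_pairing; congr pair.
Qed.

Lemma sqr_speed_gt0 s : 0 < X 1 s ^+ 2 + Y 1 s ^+ 2.
Proof.
rewrite lt_neqAle addr_ge0 ?sqr_ge0// andbT eq_sym paddr_eq0 ?sqr_ge0// !sqrf_eq0.
by case: (fregular s) => /negbTE ->; rewrite ?andbF.
Qed.

Lemma curvature_sign s :
  ((0 < curvature f s) = (0 < K s)) * ((curvature f s < 0) = (K s < 0)).
Proof.
have e0 : 0 < (enorm (f^`() s) ^+ 3)^-1.
  by rewrite invr_gt0 exprn_gt0// sqrtr_gt0; exact: sqr_speed_gt0.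
by rewrite /curvature K_det2 pmulr_lgt0// pmulr_llt0.
Qed.

(** A zero of the curvature without change of sign would be an undulation point; conversely [K] is
    continuous and has the sign of the curvature. *)
Lemma inflexionP s : inflexion f s <-> K s = 0.
Proof.
split=> [[_ cs]|K0].
  apply: changes_sign_eq0; first exact: smooth_at_continuous (K_smooth s).
  by case: cs => -[c1 c2]; [left|right]; split; [move: c1|move: c2|move: c1|move: c2];
    apply: filterS => u; rewrite curvature_sign.
split; first exact: (generic_regular f_generic).
apply: contrapT => ncs; apply: (generic_undulation f_generic (s := s)); split=> //.
by rewrite /curvature K_det2 K0 mul0r.
Qed.

Lemma K_derive_neq0 s : K s = 0 -> X 1 s * Y 3 s - Y 1 s * X 3 s != 0.
Proof. by move=> /inflexionP/(generic_inflexion f_generic)/eqP. Qed.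

(** Distinct parameters with parallel tangents have distinct images, since self-crossings are
    transversal; hence they form a parallel pair, and its points are not both inflexions. *)
Lemma parallel_K s t : circle s <> circle t -> D s t = 0 -> K s = 0 -> K t != 0.
Proof.
move=> st Dst Ks; apply/negP => /eqP Kt.
have pp : parallel_pair f s t.
  split; last by rewrite D_det2.
  by move=> fst; have := generic_crossing f_generic st fst; rewrite D_det2 => /(_ Dst).
by apply: (generic_parallel f_generic pp); split; exact/inflexionP.
Qed.

Lemma K_circle s t : circle s = circle t -> K s = K t.
Proof. by move=> st; rewrite /K !(X_circle _ st) !(Y_circle _ st). Qed.

Lemma D_circle s t s' t' : circle s = circle s' -> circle t = circle t' ->
  D s t = D s' t'.
Proof.
by move=> ss tt; rewrite /D !(X_circle _ ss) !(Y_circle _ ss) !(X_circle _ tt) !(Y_circle _ tt).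
Qed.

(* The tangent of the angle from (a, b) to the velocity of [f]; parallelism of
   two velocities becomes equality of two values of one function. *)
Section Slope.
Variables a b : R.

Definition slope_num s : R := a * Y 1 s - b * X 1 s.
Definition slope_den s : R := a * X 1 s + b * Y 1 s.
Definition slope s : R := slope_num s / slope_den s.

Lemma slope_smooth s : slope_den s != 0 -> smooth_at slope s.
Proof.
move=> e0.
have sc c (h : R -> R) : smooth_at h s -> smooth_at (fun u => c * h u) s.
  by move=> sh; apply: smooth_atM (smooth_at_cst c s) sh.
have sN : smooth_at slope_num s.
  exact: smooth_atD (sc a _ (Y_smooth 1 s)) (smooth_atN (sc b _ (X_smooth 1 s))).
have sD : smooth_at slope_den s.
  exact: smooth_atD (sc a _ (X_smooth 1 s)) (sc b _ (Y_smooth 1 s)).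
exact: smooth_atM sN (smooth_atV e0 sD).
Qed.

Lemma slope_den_derive s : is_derive s 1 slope_den (a * X 2 s + b * Y 2 s).
Proof. exact: derD (derZ a (X_derive 1 s)) (derZ b (Y_derive 1 s)). Qed.

(** For nonzero [(a, b)] the factor of [K] is positive: the critical points of the slope are the
    inflexions. *)
Lemma slope_derive s : slope_den s != 0 ->
  is_derive s 1 slope ((a ^+ 2 + b ^+ 2) * K s / slope_den s ^+ 2).
Proof.
move=> e0.
have dN : is_derive s 1 slope_num (a * Y 2 s - b * X 2 s).
  exact: derB (derZ a (Y_derive 1 s)) (derZ b (X_derive 1 s)).
refine (is_derive_eq (derM dN (derV (slope_den_derive s) e0)) _).
rewrite /slope_num /K; move: e0; rewrite /slope_den.
move: (X 1 s) (Y 1 s) (X 2 s) (Y 2 s) => x1 y1 x2 y2 e0.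
by field.
Qed.

Lemma near_slope_den s : slope_den s != 0 -> \forall u \near s, slope_den u != 0.
Proof. exact: continuous_neq0 (is_derive_continuous (slope_den_derive s)). Qed.

Lemma slope_eq s t : a ^+ 2 + b ^+ 2 != 0 -> slope_den s != 0 -> slope_den t != 0 ->
  D s t = 0 <-> slope s = slope t.
Proof. exact: proportional_slope. Qed.

End Slope.

(** Lagrange's identity: the squares of the scalar product and of the determinant of two velocities
    add up to the product of their squared lengths, so both cannot vanish. *)
Lemma slope_den_parallel s t : D s t = 0 -> slope_den (X 1 s) (Y 1 s) t != 0.
Proof.
move=> D0; apply/negP => /eqP d0.
have : (X 1 s ^+ 2 + Y 1 s ^+ 2) * (X 1 t ^+ 2 + Y 1 t ^+ 2) =
    slope_den (X 1 s) (Y 1 s) t ^+ 2 + D s t ^+ 2.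
  rewrite /slope_den /D; move: (X 1 s) (Y 1 s) (X 1 t) (Y 1 t) => x1 y1 x2 y2; ring.
rewrite D0 d0 expr0n/= addr0 => E.
by have := mulr_gt0 (sqr_speed_gt0 s) (sqr_speed_gt0 t); rewrite E ltxx.
Qed.

Lemma D_diag s : D s s = 0.
Proof. by rewrite /D mulrC subrr. Qed.

(* The lift to R^2 of the parallel set: taking the closure adds exactly the
   diagonal points at inflexions. *)
Definition parallel_lift : set (R * R) := [set p |
  (circle p.1 <> circle p.2 /\ D p.1 p.2 = 0) \/ (circle p.1 = circle p.2 /\ K p.1 = 0)].

Lemma D_swap s t : D t s = - D s t.
Proof. by rewrite /D; move: (X 1 s) (Y 1 s) (X 1 t) (Y 1 t) => *; ring. Qed.

Lemma parallel_lift_swap p : parallel_lift (swap p) <-> parallel_lift p.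
Proof.
have H q : parallel_lift q -> parallel_lift (swap q).
  case=> -[c d]; [left|right]; split=> /=.
  - by move/esym.
  - by rewrite D_swap d oppr0.
  - by [].
  - by rewrite -(K_circle c).
by split=> /H//; rewrite swapK.
Qed.

Lemma parallel_lift_torus p q : torus p = torus q -> parallel_lift p -> parallel_lift q.
Proof.
move=> [c1 c2 c3 c4].
have E1 : circle p.1 = circle q.1 by congr pair.
have E2 : circle p.2 = circle q.2 by congr pair.
by rewrite /parallel_lift/= -E1 -E2 -(D_circle E1 E2) -(K_circle E1).
Qed.

Lemma parallel_lift_period p w : lattice w -> parallel_lift p -> parallel_lift (p + w).
Proof. by move=> lw; apply: parallel_lift_torus; apply/esym/torus_eqP; exists w. Qed.

Lemma slope_diag s : slope (X 1 s) (Y 1 s) s = 0.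
Proof. by rewrite /slope /slope_num [X 1 s * _]mulrC subrr mul0r. Qed.

Lemma velocity_detE s t : D s t = X 1 s * Y 1 t - Y 1 s * X 1 t.
Proof. by []. Qed.

Lemma acceleration_detE s : K s = X 1 s * Y 2 s - Y 1 s * X 2 s.
Proof. by []. Qed.

Opaque xder yder slope slope_den velocity_det acceleration_det.

Lemma near_neq (T : topologicalType) (V : normedModType R) (g h : T -> V) x :
  {for x, continuous g} -> {for x, continuous h} -> g x <> h x ->
  \forall y \near x, g y <> h y.
Proof.
move=> gc hc gh.
have c : {for x, continuous (fun y => g y - h y)} by exact: continuousB.
have c0 : g x - h x != 0 by rewrite subr_eq0; exact/eqP.
have : \forall y \near x, g y - h y != 0 by exact: (cvgr_neq0 _ c c0).
by apply: filterS => y; rewrite subr_eq0 => /eqP.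
Qed.

Lemma circle_inj_small s t : circle s = circle t -> `|s - t| < period R -> s = t.
Proof.
move=> /circle_eqP[k ->]; rewrite addrAC subrr add0r => kP.
have lk : lattice (k%:~R * period R, k%:~R * period R) by exists k, k.
have := lattice_small lk; rewrite prod_normE/= maxxx => /(_ kP) /(congr1 fst)/= ->.
by rewrite addr0.
Qed.

Lemma near_circle_inj (c : R) :
  \forall q \near (c, c) : R * R, circle q.1 = circle q.2 -> q.1 = q.2.
Proof.
have cc : {for ((c, c) : R * R), continuous (fun q : R * R => q.1 - q.2)}.
  by apply: continuousB; [exact: fst_continuous|exact: snd_continuous].
have := near_comp_at cc (subrr c) (nbhs0_lt (period_gt0 R)).
by apply: filterS => q qP /circle_inj_small; apply.
Qed.

Lemma near_fst p (P : R -> Prop) : (\forall s \near p.1, P s) -> \forall q \near p, P q.1.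
Proof. exact: near_comp (@fst_continuous _ p). Qed.

Lemma near_snd p (P : R -> Prop) : (\forall s \near p.2, P s) -> \forall q \near p, P q.2.
Proof. exact: near_comp (@snd_continuous _ p). Qed.

Lemma near_distinct p : circle p.1 <> circle p.2 -> \forall q \near p, circle q.1 <> circle q.2.
Proof.
apply: (near_neq (g := circle \o fst) (h := circle \o snd)).
  by apply: continuous_comp; [exact: fst_continuous|exact: circle_continuous].
by apply: continuous_comp; [exact: snd_continuous|exact: circle_continuous].
Qed.

Lemma near_slope_eq p : D p.1 p.2 = 0 ->
  \forall q \near p, D q.1 q.2 = 0 <->
    slope (X 1 p.1) (Y 1 p.1) q.1 = slope (X 1 p.1) (Y 1 p.1) q.2.
Proof.
move=> D0; have e0 := lt0r_neq0 (sqr_speed_gt0 p.1).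
move: (near_fst (near_slope_den (slope_den_parallel (D_diag p.1)))).
move: (near_snd (near_slope_den (slope_den_parallel D0))).
by apply: filterS2 => q q2 q1; exact: (slope_eq e0 q1 q2).
Qed.

Lemma near_slope_smooth s t : D s t = 0 ->
  \forall u \near t, smooth_at (slope (X 1 s) (Y 1 s)) u.
Proof.
move=> /slope_den_parallel/near_slope_den; apply: filterS => u; exact: slope_smooth.
Qed.

Lemma slope_derive1 s t : D s t = 0 -> (derive1 (slope (X 1 s) (Y 1 s)) t == 0) = (K t == 0).
Proof.
move=> D0; have sd := slope_den_parallel D0.
have e0 := lt0r_neq0 (sqr_speed_gt0 s).
rewrite (derive1_val (slope_derive sd)); move: sd e0.
move: (slope_den _ _ _) (_ + _) (K t) => d c k d0 c0.
by rewrite mulf_eq0 mulf_eq0 invr_eq0 expf_eq0/= (negbTE d0) (negbTE c0) orbF.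
Qed.

(** Parallelism near [p] reads [m s = m t], and [m] is invertible near [p.2] because [K p.2] is
    nonzero. Pairs whose second point is an inflexion are reached through [swap]. *)
Lemma parallel_lift_graph_distinct p : circle p.1 <> circle p.2 -> D p.1 p.2 = 0 ->
  K p.2 != 0 -> graph_at parallel_lift p.
Proof.
move=> c12 D0 K2.
pose m := slope (X 1 p.1) (Y 1 p.1).
have sm1 := near_slope_smooth (D_diag p.1); have sm2 := near_slope_smooth D0.
have m12 : m p.1 = m p.2 by apply/(nbhs_singleton (near_slope_eq D0)).
have [|g [mg gm sg]] := local_inverse sm2; first by rewrite slope_derive1.
have mc := smooth_at_continuous (nbhs_singleton sm1).
exists (g \o m); split.
  move: sm1 (near_comp_at mc m12 sg); apply: filterS2 => s; exact: smooth_at_comp.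
have gm1 : \forall q \near p, m (g (m q.1)) = m q.1.
  exact: (near_fst (P := fun s => m (g (m s)) = m s) (near_comp_at mc m12 gm)).
have mg2 : \forall q \near p, g (m q.2) = q.2.
  exact: (near_snd (P := fun t => g (m t) = t) mg).
move: gm1 mg2 (near_distinct c12) (near_slope_eq D0).
apply: filterS4 => q E1 E2 cq Dq; split.
  by case=> -[cq0 Dq0]; [exact: (eq_trans (esym E2) (congr1 g (esym (Dq.1 Dq0))))|case: (cq cq0)].
by move=> /= q2; left; split; [exact: cq|apply/Dq; rewrite q2; exact/esym].
Qed.

(** The derivative of the slope is [K] times a nonvanishing factor. At a zero of [K] its second
    derivative is thus the derivative of [K], which is det(f', f'''), times that factor. *)
Lemma slope_K0_morse s : K s = 0 -> exists (m : R -> R) (k : R),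
  [/\ \forall x \near s, smooth_at m x, m s = 0, m^`()%classic s != 0, k != 0 &
    \forall x \near s, slope (X 1 s) (Y 1 s) x = k * m x ^+ 2].
Proof.
move=> K0; have D0 := D_diag s.
apply: morse.
- exact: near_slope_smooth.
- exact: slope_diag.
- by apply/eqP; rewrite slope_derive1// K0.
- have sd := slope_den_parallel D0.
  pose c := X 1 s ^+ 2 + Y 1 s ^+ 2.
  pose d := slope_den (X 1 s) (Y 1 s).
  have dE : {near s, (fun u => c * K u * (d u ^+ 2)^-1) =1 (slope (X 1 s) (Y 1 s))^`()}.
    by move: (near_slope_den sd); apply: filterS => u /slope_derive/derive1_val ->.
  have dd := slope_den_derive (X 1 s) (Y 1 s) s.
  have dd2 := derM dd dd.
  have d20 : d s * d s != 0 by rewrite mulf_neq0.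
  have : is_derive s 1 (slope (X 1 s) (Y 1 s))^`()
     (c * (X 1 s * Y 3 s - Y 1 s * X 3 s) * (d s * d s)^-1).
    apply: near_eq_is_derive dE _.
    refine (is_derive_eq (derM (derZ c (K_derive s)) (derV dd2 d20)) _).
    rewrite K0; move: (_ * _ - _ * _) (- _ * _) (_^-1) => x y z.
    by rewrite mulr0 mul0r addr0.
  move=> /derive1_val; rewrite derive1nS derive1n1 => ->.
  apply: mulf_neq0; last by rewrite invr_neq0.
  by apply: mulf_neq0; [exact: lt0r_neq0 (sqr_speed_gt0 s)|exact: K_derive_neq0].
Qed.

(* The slope at an inflexion is k m^2, so that nearby parallel pairs are the
   (s, t) with m s = m t, the diagonal, and those with m s = - m t. *)
Lemma near_diag_graph s0 : K s0 = 0 -> exists (phi : R -> R),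
  (\forall s \near s0, smooth_at phi s) /\
  (\forall r \near (s0, s0) : R * R, parallel_lift r <-> r.2 = phi r.1).
Proof.
move=> K0; have [m [k [sm m0 dm k0 mE]]] := slope_K0_morse K0.
have [g [mg gm sg]] := local_inverse sm dm; rewrite m0 in gm sg.
have mc := smooth_at_continuous (nbhs_singleton sm).
have nm0 : - m s0 = 0 by rewrite m0 oppr0.
have nmc : {for s0, continuous (fun s => - m s)} by apply: continuousN.
have g0 : g 0 = s0 by rewrite -m0; exact: (nbhs_singleton mg).
exists (fun s => g (- m s)); split.
  move: sm (near_comp_at nmc nm0 sg); apply: filterS2 => s sms sgs.
  exact: (smooth_at_comp (smooth_atN sms) sgs).
pose p : R * R := (s0, s0).
have n1 : \forall r \near p, D r.1 r.2 = 0 <->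
    slope (X 1 s0) (Y 1 s0) r.1 = slope (X 1 s0) (Y 1 s0) r.2.
  exact: (@near_slope_eq p) (D_diag s0).
have n21 : \forall r \near p, slope (X 1 s0) (Y 1 s0) r.1 = k * m r.1 ^+ 2.
  exact: (near_fst (p := p) mE).
have n22 : \forall r \near p, slope (X 1 s0) (Y 1 s0) r.2 = k * m r.2 ^+ 2.
  exact: (near_snd (p := p) mE).
have n3 : \forall r \near p, circle r.1 = circle r.2 -> r.1 = r.2.
  exact: near_circle_inj.
have n41 : \forall r \near p, g (m r.1) = r.1.
  exact: (near_fst (p := p) (P := fun s => g (m s) = s) mg).
have n42 : \forall r \near p, g (m r.2) = r.2.
  exact: (near_snd (p := p) (P := fun s => g (m s) = s) mg).
have n43 : \forall r \near p, m (g (- m r.1)) = - m r.1.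
  exact: (near_fst (p := p) (P := fun s => m (g (- m s)) = - m s)
    (near_comp_at nmc nm0 gm)).
(* Zeros of [K] are isolated, so [(s0, s0)] is the only diagonal point of the lift nearby. *)
have n5 : \forall r \near p, K r.1 = K s0 -> r.1 = s0.
  exact: (near_fst (p := p) (derive_neq0_loc_inj (K_derive s0) (K_derive_neq0 K0))).
rewrite K0 in n5.
suff : \forall r \near p, parallel_lift r <-> r.2 = g (- m r.1) by [].
have [n2 n4 n13 n35] := And4 (filterI n21 n22) (filterI n41 n42) (filterI n1 n3) (filterI n43 n5).
move: n2 n4 n13 n35; apply: filterS4 => -[s t] /= [E1 E2] [G1 G2] [DE CE] [G3 KE].
have msq (a b : R) : k * a ^+ 2 = k * b ^+ 2 <-> a = b \/ a = - b.
  split=> [/(mulfI k0)/eqP|[] ->]; last by rewrite sqrrN.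
    by rewrite eqf_sqr => /orP[] /eqP ->; [left|right].
  by [].
have {DE} : D s t = 0 <-> m s = m t \/ m s = - m t.
  by rewrite -msq -E1 -E2.
move=> DE; split.
  case=> /= -[cst].
    move=> /DE[mst|mst].
      by case: cst; rewrite -G1 -G2 mst.
    by rewrite mst opprK G2.
  by move=> /KE se; rewrite -(CE cst) se m0 oppr0 g0.
move=> tE; have mt : m t = - m s by rewrite tE G3.
have [cst|cst] := pselect (circle s = circle t); last first.
  by left; split; [exact: cst|apply/DE; right; rewrite mt opprK].
right; split; first exact: cst.
move: mt; rewrite -(CE cst) => ms.
have ms0 : m s = 0.
  by move/eqP: ms; rewrite -subr_eq0 opprK -mulr2n mulrn_eq0 => /eqP.
have -> : (s, s).1 = s0 by rewrite /= -G1 ms0 g0.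
exact: K0.
Qed.

Lemma parallel_lift_graph_diag p : circle p.1 = circle p.2 -> K p.1 = 0 -> graph_at parallel_lift p.
Proof.
move=> cp K0; have [phi [sphi phiE]] := near_diag_graph K0.
have [k kE] := (circle_eqP _ _).1 (esym cp).
pose w : R * R := (0, k%:~R * period R).
have lw : lattice w by exists 0, k; rewrite /w mul0r.
have pE : p - w = (p.1, p.1).
  by rewrite [p]surjective_pairing kE; congr pair => /=; rewrite ?subr0 ?addrK.
exists (fun s => phi s + k%:~R * period R); split.
  move: sphi; apply: filterS => s ss; apply: smooth_atD => //; exact: smooth_at_cst.
have sc : {for p, continuous (fun q => q - w)}.
  by apply: continuousB => //; exact: cst_continuous.
have := near_comp_at sc pE phiE; apply: filterS => q /= qE.
rewrite (_ : parallel_lift q <-> parallel_lift (q - w)); last first.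
  split=> [/(parallel_lift_period (latticeN lw))//|/(parallel_lift_period lw)].
  by rewrite subrK.
rewrite qE /= subr0.
by split=> [/eqP|->]; [rewrite subr_eq => /eqP|rewrite addrK].
Qed.

Lemma parallel_lift_locally_graph : locally_graph parallel_lift.
Proof.
have sE : (@swap R) @^-1` parallel_lift = parallel_lift.
  by apply/seteqP; split=> q /parallel_lift_swap.
move=> p [[cp D0]|[cp K0]]; last by left; exact: parallel_lift_graph_diag.
have [K2|K2] := eqVneq (K p.2) 0; last by left; exact: parallel_lift_graph_distinct.
right; rewrite sE; apply: parallel_lift_graph_distinct => /=.
- by move/esym.
- by rewrite D_swap D0 oppr0.
- by apply: (parallel_K _ _ K2); [move/esym|rewrite D_swap D0 oppr0].
Qed.

Lemma D_continuous p : {for p, continuous (fun q => D q.1 q.2)}.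
Proof.
have c1 (h : R -> R) : smooth_at h p.1 -> {for p, continuous (fun q => h q.1)}.
  move=> sh; apply: (continuous_comp (f := fst) (g := h)); first exact: fst_continuous.
  exact: smooth_at_continuous.
have c2 (h : R -> R) : smooth_at h p.2 -> {for p, continuous (fun q => h q.2)}.
  move=> sh; apply: (continuous_comp (f := snd) (g := h)); first exact: snd_continuous.
  exact: smooth_at_continuous.
have := continuousB
  (continuousM (c1 _ (X_smooth 1 p.1)) (c2 _ (Y_smooth 1 p.2)))
  (continuousM (c1 _ (Y_smooth 1 p.1)) (c2 _ (X_smooth 1 p.2))).
exact.
Qed.

Lemma parallel_lift_closed : closed parallel_lift.
Proof.
move=> p clp; have [cp|cp] := pselect (circle p.1 = circle p.2); last first.
  left; split=> //; apply/eqP/negPn/negP => D0.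
  have nD : \forall q \near p, D q.1 q.2 != 0 by exact: (cvgr_neq0 _ (@D_continuous p) D0).
  have [q [[[_ qD]|[qc _]] [cq Dq]]] := clp _ (filterI (near_distinct cp) nD).
    by rewrite qD eqxx in Dq.
  exact: cq.
right; split=> //; apply/eqP/negPn/negP => K0.
have [k kE] := (circle_eqP _ _).1 (esym cp).
pose w : R * R := (0, k%:~R * period R).
have lw : lattice w by exists 0, k; rewrite /w mul0r.
have pE : p - w = (p.1, p.1).
  by rewrite [p]surjective_pairing kE; congr pair => /=; rewrite ?subr0 ?addrK.
have sc : {for p, continuous (fun q => q - w)}.
  by apply: continuousB => //; exact: cst_continuous.
pose p' : R * R := (p.1, p.1).
pose m := slope (X 1 p.1) (Y 1 p.1).
(* Off the inflexions the slope is injective near [p.1], so pairs of distinct parallel parameters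
   cannot accumulate at this diagonal point. *)
have [|g [mg _ _]] := local_inverse (near_slope_smooth (D_diag p.1)).
  by rewrite slope_derive1// D_diag.
have n1 : \forall r \near p', D r.1 r.2 = 0 <-> m r.1 = m r.2.
  exact: (@near_slope_eq p') (D_diag p.1).
have n41 : \forall r \near p', g (m r.1) = r.1.
  exact: (near_fst (p := p') (P := fun s => g (m s) = s) mg).
have n42 : \forall r \near p', g (m r.2) = r.2.
  exact: (near_snd (p := p') (P := fun s => g (m s) = s) mg).
have n5 : \forall r \near p', K r.1 != 0.
  exact: (near_fst (p := p') (continuous_neq0 (smooth_at_continuous (K_smooth p.1)) K0)).
have : \forall r \near p', ~ parallel_lift r.
  move: n1 n41 n42 n5; apply: filterS4 => r Dr g1 g2 Kr [[cr /Dr mr]|[_ Kr0]].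
    by apply: cr; rewrite -g1 -g2 mr.
  by rewrite Kr0 eqxx in Kr.
move=> /(near_comp_at sc pE)/clp[q [Eq]]; apply.
exact: parallel_lift_period (latticeN lw) Eq.
Qed.

(** The delicate point is that a diagonal point at an inflexion is a limit of pairs of distinct
    parameters. The arc through it supplies them: were the arc on the diagonal at a small time, it
    would be at a zero of [K], hence, those being isolated, at the same point, to which it does not
    return at small nonzero times. *)
Lemma parallel_setE : parallel_set f = torus @` parallel_lift.
Proof.
have tc : closed (torus @` parallel_lift).
  exact: torus_closed parallel_lift_closed parallel_lift_period.
apply/seteqP; split.
  apply: subset_trans tc; apply: closureS => _ [p [cp Dp] <-]; exists p => //.
  by left; split=> //; rewrite -D_det2.
move=> _ [p Ep <-]; have [[cp Dp]|[cp K0]] := Ep.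
  by apply: subset_closure; exists p => //; split=> //; rewrite D_det2.
have [g Ag g0] := garc_exists parallel_lift_locally_graph parallel_lift_closed
  parallel_lift_period Ep.
have gc := arc_at_continuous (Ag 0).
have [k kE] := (circle_eqP _ _).1 (esym cp).
pose w : R * R := (0, k%:~R * period R).
move=> U Up.
have ntU : \forall u \near (0 : R), U (torus (g u)).
  exact: (near_comp_at gc g0 (near_comp (@torus_continuous R p) Up)).
have nK : \forall u \near (0 : R), K (g u).1 = 0 -> (g u).1 = p.1.
  have := derive_neq0_loc_inj (K_derive p.1) (K_derive_neq0 K0); rewrite K0 => nK.
  exact: near_comp_at gc g0 (near_fst nK).
have nC : \forall u \near (0 : R), circle (g u).1 = circle (g u).2 ->
    (g u).2 = (g u).1 + k%:~R * period R.
  have lw : lattice w by exists 0, k; rewrite /w mul0r.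
  have pE : p - w = (p.1, p.1).
    by rewrite [p]surjective_pairing kE; congr pair => /=; rewrite ?subr0 ?addrK.
  have sc : {for p, continuous (fun q => q - w)}.
    by apply: continuousB => //; exact: cst_continuous.
  have := near_comp_at gc g0 (near_comp_at sc pE (near_circle_inj p.1)).
  apply: filterS => u /= H cu.
  apply/eqP; rewrite -subr_eq; apply/eqP/esym.
  move: H; rewrite subr0; apply.
  by rewrite cu; apply/circle_eqP; exists k; rewrite subrK.
have nI := garc_loc_inj 0 Ag; rewrite g0 in nI.
have : \forall u \near (0 : R)^', U (torus (g u)) /\ circle (g u).1 <> circle (g u).2.
  rewrite near_withinE; move: ntU nK nC nI; apply: filterS4 => u Uu Ku Cu Iu u0.
  split=> // cu.
  have : parallel_lift (g u) by case: (Ag u).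
  case=> -[cu' KD]; first exact: (cu' cu).
  have gu1 := Ku KD; move/eqP: u0; apply; apply: Iu.
  rewrite [RHS]surjective_pairing kE [LHS]surjective_pairing; congr pair => //.
  by rewrite Cu// gu1.
move=> H; have [u [Uu cu]] := @filter_ex _ (0 : R)^' _ _ H.
exists (torus (g u)); split; last exact: Uu.
exists (g u); last by [].
split; first exact: cu.
rewrite D_det2; have [Eu _ _] := Ag u.
by case: Eu => -[cu' KD]; [exact: KD|case: (cu cu')].
Qed.

End Curve.

(** * Counting the values of a two-to-one map *)

Section Counting.

Lemma card_remove (T : choiceType) (A : set T) (x : T) (n : nat) :
  (A #= `I_n.+1)%card -> A x -> (A `\ x #= `I_n)%card.
Proof.
move=> An Ax; have fA : finite_set A by apply/finite_setP; exists n.+1.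
have xA : x \in fset_set A by rewrite in_fset_set//; apply/mem_set.
have fAx : finite_set (A `\ x) by exact: finite_setD.
rewrite -(fset_setK fAx); apply/card_eq_fsetP.
rewrite fset_setD1//; have := card_fset_set An.
by rewrite (cardfsD1 x) xA => -[].
Qed.

(** Induction on [n], removing a whole fibre at a time so that the remaining ones keep their two
    elements. *)
Lemma card_two_to_one (T : choiceType) (U : Type) (F : T -> U) (n : nat) (A : set T) :
  (A #= `I_(2 * n))%card ->
  (forall a, A a -> exists a', [/\ A a', a' <> a &
    forall b, A b -> F b = F a <-> b = a \/ b = a']) ->
  (F @` A #= `I_n)%card.
Proof.
elim: n A => [|n IH] A.
  by rewrite muln0 II0 card_eq0 => /eqP -> _; rewrite image_set0.
rewrite mulnS => An HA.
have /eq_cardSP[a Aa _] := An.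
have [a' [Aa' a'a Ha]] := HA a Aa.
have A2 : (A `\ a `\ a' #= `I_(2 * n))%card.
  by apply: card_remove; [exact: card_remove An Aa|split].
apply/eq_cardSP; exists (F a); first by exists a.
rewrite (_ : _ `\ _ = F @` (A `\ a `\ a')).
  apply: IH A2 _ => b [[Ab ba] ba'].
  have [b' [Ab' b'b Hb]] := HA b Ab; exists b'; split=> //; last first.
    by move=> c [[Ac _] _]; exact: Hb.
  have FbE : F b' = F b by apply/(Hb b' Ab'); right.
  split; first split=> //.
    by move=> b'E; have /(Ha b Ab)[] := esym (etrans (esym (congr1 F b'E)) FbE).
  by move=> b'E; have /(Ha b Ab)[] // : F b = F a; rewrite -FbE b'E; apply/(Ha a' Aa'); right.
apply/seteqP; split=> [_ [[b Ab <-] /= Fba]|_ [b [[Ab ba] ba'] <-]].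
  by exists b => //; split; [split=> // bE|move=> bE]; apply: Fba; apply/(Ha b Ab); [left|right].
by split; [exists b|move=> /(Ha b Ab)[]].
Qed.

End Counting.

(** * Passages through the diagonal *)

Section Symmetry.
Variables (R : realType) (f : R -> R * R).
Hypothesis f_curve : closed_regular_curve f.
Hypothesis f_generic : generic f.
Implicit Types (p q w : R * R) (g : R -> R * R) (c u v : R).

Local Notation E := (parallel_lift f).
Local Notation K := (acceleration_det f).
Local Notation D := (velocity_det f).
Local Notation X := (xder f).
Local Notation Y := (yder f).
Let SG := parallel_lift_locally_graph f_curve f_generic.
Let Scl := parallel_lift_closed f_curve f_generic.
Let Sper := parallel_lift_period f_curve.

Lemma garc_swap g : garc E g -> garc E (@swap R \o g).
Proof.
move=> Ag u; apply/arc_at_swap.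
rewrite (_ : _ @^-1` _ = E); first exact: Ag.
by apply/seteqP; split=> q /(parallel_lift_swap f_curve).
Qed.

(** The swapped arc passes through the same point of the torus, so it is the same arc up to a
    lattice vector and a sign; the point is that the sign is -1. *)
Lemma garc_diag_symmetric g c : garc E g -> circle (g c).1 = circle (g c).2 ->
  exists2 w, lattice w & forall h : R, g (c + h) = swap (g (c - h)) + w.
Proof.
move=> Ag cg.
have : torus (g c) = torus ((@swap R \o g) c) by rewrite /torus /= cg.
move=> /torus_eqP[w lw gw]; exists w => //.
have [e /sqr_eq1[->|->] Eh] :=
  garc_compare SG Ag (garc_translate Sper lw (garc_swap Ag)) gw; last first.
  by move=> h; rewrite Eh mulN1r.
(* With the other sign the arc would stay in the diagonal, where the zeros of
   [K] are isolated. *)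
exfalso.
have gs u : g u = swap (g u) + w.
  by have := Eh (u - c); rewrite mul1r [c + _]addrC subrK.
have cu u : circle (g u).1 = circle (g u).2.
  have : torus (g u) = torus (swap (g u)) by apply/torus_eqP; exists w.
  by move=> [a b _ _]; congr pair.
have Kg u : K (g u).1 = 0.
  by have [Eu _ _] := Ag u; case: Eu => -[cE KE]; [case: (cE (cu u))|exact: KE].
have gc := arc_at_continuous (Ag c).
have nK := derive_neq0_loc_inj (K_derive f_curve (g c).1) (K_derive_neq0 f_curve f_generic (Kg c)).
have : \forall u \near c, u = c.
  move: (near_comp_at gc erefl (near_fst nK)) (garc_loc_inj c Ag).
  apply: filterS2 => u KE; apply.
  have g1 := KE (etrans (Kg u) (esym (Kg c))).
  rewrite [LHS]surjective_pairing [RHS]surjective_pairing; congr pair; first exact: g1.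
  have g2 v : (g v).2 = (g v).1 + w.2 by rewrite {1}gs.
  by rewrite !g2 g1.
move=> /nbhs_ballP[e0 /= e00 /(_ (c + e0 / 2))].
rewrite /ball/= opprD addNKr normrN gtr0_norm ?divr_gt0// ltr_pdivrMr// ltr_pMr// ltr1n.
move=> /(_ isT) /eqP; rewrite -subr_eq0 addrAC subrr add0r mulf_eq0 invr_eq0 pnatr_eq0 orbF.
by rewrite gt_eqF.
Qed.

(** Differentiating the symmetry about [c] makes the two coordinate velocities opposite; unit speed
    then keeps them from vanishing. *)
Lemma garc_diag_derive g c : garc E g -> circle (g c).1 = circle (g c).2 ->
  (fst \o g)^`()%classic c = - (snd \o g)^`()%classic c /\ (fst \o g)^`()%classic c != 0.
Proof.
move=> Ag cg; have [w lw gs] := garc_diag_symmetric Ag cg.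
have [_ [g1 g2] v1] := Ag c.
have cE : c + -1 * (c - c) = c by rewrite subrr mulr0 addr0.
have dE : (fst \o g)^`()%classic c = - (snd \o g)^`()%classic c.
  have fE : fst \o g = (fun u => (snd \o g) (c + -1 * (u - c)) + w.1).
    apply/funext => u /=; have := gs (u - c); rewrite [c + _]addrC subrK => ->.
    by rewrite mulN1r.
  have d2 : is_derive (c + -1 * (c - c)) 1 (snd \o g) ((snd \o g)^`()%classic c).
    by rewrite cE; exact: smooth_at_is_derive.
  rewrite fE; apply: derive1_val.
  have := derD
    (derComp (g := fun v => c + -1 * (v - c)) d2 (affine_is_derive c (-1) c c))
    (is_derive_cst w.1 c 1).
  by rewrite addr0 mulrN1.
split=> //; apply/eqP => d10; move: v1; rewrite /speed2 d10.
have -> : (snd \o g)^`()%classic c = 0 by apply/eqP; rewrite -oppr_eq0 -dE d10.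
by rewrite expr0n/= addr0 => /eqP; rewrite eq_sym oner_eq0.
Qed.

(** Off the diagonal a zero would be a self-crossing with parallel tangents, against
    transversality. *)
Lemma secant_eq0 p : E p -> secant f p = 0 <-> circle p.1 = circle p.2.
Proof.
move=> Ep; rewrite /secant; split=> [/eqP|cp]; last first.
  by apply/eqP; rewrite subr_eq0; apply/eqP; exact: (fder_circle f_curve 0 cp).
rewrite subr_eq0 => /eqP fp; case: Ep => -[cE KE] //.
by exfalso; have := generic_crossing f_generic cE fp; rewrite D_det2 => /(_ KE).
Qed.

Lemma changes_sign_pmul (h k r : R -> R) u :
  (\forall v \near u, 0 < r v) -> (\forall v \near u, k v = r v * h v) ->
  changes_sign h u -> changes_sign k u.
Proof.
move=> r0 kE.
have sgn v : 0 < r v -> k v = r v * h v -> (0 < k v) = (0 < h v) /\ (k v < 0) = (h v < 0).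
  by move=> rv ->; rewrite pmulr_rgt0// pmulr_rlt0.
have n : \forall v \near u, (0 < k v) = (0 < h v) /\ (k v < 0) = (h v < 0).
  by move: r0 kE; apply: filterS2 => v; exact: sgn.
have [nl nr] := (near_at_left n, near_at_right n).
case=> -[hl hr]; [left|right]; split.
- by move: nl hl; apply: filterS2 => v [_ ->].
- by move: nr hr; apply: filterS2 => v [-> _].
- by move: nl hl; apply: filterS2 => v [-> _].
- by move: nr hr; apply: filterS2 => v [_ ->].
Qed.

(* If the velocity (A, B) of [f] at t is l times the velocity (a, b) at s, then the
   secant has velocity (s' - l t') (a, b), and the derivative of the
   parallelism relation makes its acceleration determinant proportional to the
   one of [f] at s alone. *)
Lemma parallel_acceleration (a b a2 b2 A B A2 B2 x1 y1 x2 y2 : R) :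
  a ^+ 2 + b ^+ 2 != 0 -> a * B - b * A = 0 ->
  a2 * x1 * B + a * (B2 * y1) - (b2 * x1 * A + b * (A2 * y1)) = 0 ->
  let l := (a * A + b * B) / (a ^+ 2 + b ^+ 2) in
  [/\ a * x1 - A * y1 = a * (x1 - l * y1), b * x1 - B * y1 = b * (x1 - l * y1) &
  (a * x1 - A * y1) * (b2 * x1 * x1 + b * x2 - (B2 * y1 * y1 + B * y2)) -
  (b * x1 - B * y1) * (a2 * x1 * x1 + a * x2 - (A2 * y1 * y1 + A * y2)) =
  (x1 - l * y1) ^+ 2 * ((a * b2 - b * a2) * x1)].
Proof.
move=> ab0 par; have AE : A = (a * A + b * B) / (a ^+ 2 + b ^+ 2) * a.
  apply: (mulfI ab0); rewrite mulrA mulrCA mulfV// mulr1.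
  apply/eqP; rewrite -subr_eq0; apply/eqP.
  rewrite (_ : _ - _ = - b * (a * B - b * A)); last by ring.
  by rewrite par mulr0.
have BE : B = (a * A + b * B) / (a ^+ 2 + b ^+ 2) * b.
  apply: (mulfI ab0); rewrite mulrA mulrCA mulfV// mulr1.
  apply/eqP; rewrite -subr_eq0; apply/eqP.
  rewrite (_ : _ - _ = a * (a * B - b * A)); last by ring.
  by rewrite par mulr0.
move=> dpar l; rewrite -/l in AE BE.
move: dpar; rewrite AE BE => dpar; split; [ring|ring|].
apply/eqP; rewrite -subr_eq0; apply/eqP.
rewrite (_ : _ - _ = - (x1 - l * y1) * y1 *
  (a2 * x1 * (l * b) + a * (B2 * y1) - (b2 * x1 * (l * a) + b * (A2 * y1)))); last by ring.
by rewrite dpar mulr0.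
Qed.

(** The signed curvature of the secant is [h] times [rho ^ 2] over the cube of its speed. At [u]
    both velocities of [f] coincide, so [l u = 1] and [rho u] is twice the derivative of [x], hence
    nonzero; and [h] has a simple zero there because [K] has one. *)
Lemma secant_inflexion (s : R -> R * R) u :
  (forall v, vsmooth_at s v) -> (forall v, E (s v)) ->
  circle (s u).1 = circle (s u).2 ->
  (fst \o s)^`()%classic u = - (snd \o s)^`()%classic u ->
  (fst \o s)^`()%classic u != 0 -> inflexion (secant f \o s) u.
Proof.
move=> ss Es cu dxy dx0.
pose x := fst \o s; pose y := snd \o s; pose dx : R -> R := x^`(); pose dy : R -> R := y^`().
have sx v : smooth_at x v by case: (ss v).
have sy v : smooth_at y v by case: (ss v).
have dX n v : is_derive v 1 (fun t => X n (x t)) (X n.+1 (x v) * dx v).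
  exact: derComp (X_derive f_curve n (x v)) (smooth_at_is_derive (sx v)).
have dX' n v : is_derive v 1 (fun t => X n (y t)) (X n.+1 (y v) * dy v).
  exact: derComp (X_derive f_curve n (y v)) (smooth_at_is_derive (sy v)).
have dY n v : is_derive v 1 (fun t => Y n (x t)) (Y n.+1 (x v) * dx v).
  exact: derComp (Y_derive f_curve n (x v)) (smooth_at_is_derive (sx v)).
have dY' n v : is_derive v 1 (fun t => Y n (y t)) (Y n.+1 (y v) * dy v).
  exact: derComp (Y_derive f_curve n (y v)) (smooth_at_is_derive (sy v)).
have ddx v := smooth_at_is_derive (smooth_at_derive1 (sx v)).
have ddy v := smooth_at_is_derive (smooth_at_derive1 (sy v)).
pose c1 v := X 1 (x v) * dx v - X 1 (y v) * dy v.
pose c2 v := Y 1 (x v) * dx v - Y 1 (y v) * dy v.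
have cE : (secant f \o s)^`() = (fun v => (c1 v, c2 v)).
  apply/funext => v; apply: derive1_val; apply/is_derive_pair; split.
    exact: derB (dX 0%N v) (dX' 0%N v).
  exact: derB (dY 0%N v) (dY' 0%N v).
pose d1 v := X 2 (x v) * dx v * dx v + X 1 (x v) * derive1 dx v -
  (X 2 (y v) * dy v * dy v + X 1 (y v) * derive1 dy v).
pose d2 v := Y 2 (x v) * dx v * dx v + Y 1 (x v) * derive1 dx v -
  (Y 2 (y v) * dy v * dy v + Y 1 (y v) * derive1 dy v).
have cE2 v : (secant f \o s)^`(2) v = (d1 v, d2 v).
  rewrite derive1nS derive1n1 cE; apply: derive1_val; apply/is_derive_pair; split.
    exact: derB (derM (dX 1%N v) (ddx v)) (derM (dX' 1%N v) (ddy v)).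
  exact: derB (derM (dY 1%N v) (ddx v)) (derM (dY' 1%N v) (ddy v)).
have par v : X 1 (x v) * Y 1 (y v) - Y 1 (x v) * X 1 (y v) = 0.
  rewrite -velocity_detE; case: (Es v) => -[cv KD]; first exact: KD.
  by rewrite (D_circle f_curve cv erefl) D_diag.
have dpar v : X 2 (x v) * dx v * Y 1 (y v) + X 1 (x v) * (Y 2 (y v) * dy v) -
    (Y 2 (x v) * dx v * X 1 (y v) + Y 1 (x v) * (X 2 (y v) * dy v)) = 0.
  have := derB (derM (dX 1%N v) (dY' 1%N v)) (derM (dY 1%N v) (dX' 1%N v)).
  have -> : (fun t => X 1 (x t) * Y 1 (y t) - Y 1 (x t) * X 1 (y t)) = cst 0.
    by apply/funext => t; rewrite par.
  by move=> /derive1_val <-; exact: derive1_cst.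
have sp v := lt0r_neq0 (sqr_speed_gt0 f_generic (x v)).
pose l v := (X 1 (x v) * X 1 (y v) + Y 1 (x v) * Y 1 (y v)) / (X 1 (x v) ^+ 2 + Y 1 (x v) ^+ 2).
pose rho v : R := dx v - l v * dy v.
have key v := @parallel_acceleration _ _ _ _ _ _ _ _ _ _
  (derive1 dx v) (derive1 dy v) (sp v) (par v) (dpar v).
have sX v : smooth_at (fun t => X 1 (x t)) v.
  exact: smooth_at_comp (sx v) (X_smooth f_curve 1 (x v)).
have sY v : smooth_at (fun t => Y 1 (x t)) v.
  exact: smooth_at_comp (sx v) (Y_smooth f_curve 1 (x v)).
have sX' v : smooth_at (fun t => X 1 (y t)) v.
  exact: smooth_at_comp (sy v) (X_smooth f_curve 1 (y v)).
have sY' v : smooth_at (fun t => Y 1 (y t)) v.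
  exact: smooth_at_comp (sy v) (Y_smooth f_curve 1 (y v)).
have sl : smooth_at l u.
  have s2 : smooth_at (fun t => X 1 (x t) ^+ 2 + Y 1 (x t) ^+ 2) u.
    exact: smooth_atD (smooth_atM (sX u) (sX u)) (smooth_atM (sY u) (sY u)).
  have s1 : smooth_at (fun t => X 1 (x t) * X 1 (y t) + Y 1 (x t) * Y 1 (y t)) u.
    exact: smooth_atD (smooth_atM (sX u) (sX' u)) (smooth_atM (sY u) (sY' u)).
  exact: smooth_atM s1 (smooth_atV (f := fun t => X 1 (x t) ^+ 2 + Y 1 (x t) ^+ 2) (sp u) s2).
have rc : {for u, continuous rho}.
  apply: smooth_at_continuous; apply: smooth_atD; first exact: smooth_at_derive1.
  by apply: smooth_atN; apply: smooth_atM => //; exact: smooth_at_derive1.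
have l1 : l u = 1.
  rewrite /l -(X_circle f_curve 1 cu) -(Y_circle f_curve 1 cu) -!expr2 divff//.
have r0 : rho u != 0.
  rewrite /rho l1 mul1r -[dy u]opprK -[- dy u]dxy opprK -mulr2n mulrn_eq0.
  exact: dx0.
pose h v := K (x v) * dx v.
have Kx : K (x u) = 0.
  by have := Es u; case=> -[cv KD]; [case: (cv cu)|exact: KD].
have hs : changes_sign h u.
  have dh := derM (derComp (K_derive f_curve (x u)) (smooth_at_is_derive (sx u))) (ddx u).
  apply: (derive_neq0_changes_sign dh); last by rewrite /h Kx mul0r.
  rewrite Kx mul0r addr0; apply: mulf_neq0; last exact: dx0.
  by apply: mulf_neq0; [exact: K_derive_neq0|exact: dx0].
have c12 v : rho v != 0 -> 0 < c1 v ^+ 2 + c2 v ^+ 2.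
  move=> rv; have [E1 E2 _] := key v; rewrite /c1 /c2 E1 E2 !exprMn -mulrDl.
  apply: mulr_gt0; first exact: sqr_speed_gt0.
  by rewrite lt_neqAle sqr_ge0 andbT eq_sym sqrf_eq0.
split.
  rewrite cE => -[c10 c20]; have := c12 u r0.
  by rewrite c10 c20 expr0n/= addr0 ltxx.
have nr := continuous_neq0 rc r0.
apply: (@changes_sign_pmul h _ (fun v => rho v ^+ 2 / Num.sqrt (c1 v ^+ 2 + c2 v ^+ 2) ^+ 3)) hs.
- move: nr; apply: filterS => v rv; rewrite divr_gt0//.
    by rewrite lt_neqAle sqr_ge0 andbT eq_sym sqrf_eq0.
  by rewrite exprn_gt0// sqrtr_gt0; exact: c12.
- apply: filterE => v; rewrite /curvature cE2 cE.
  have [_ _ kE] := key v.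
  have -> : det2 (c1 v, c2 v) (d1 v, d2 v) = rho v ^+ 2 * h v.
    rewrite /h acceleration_detE; exact: kE.
  by rewrite mulrAC.
Qed.

End Symmetry.

(** * Branches and their visits of the origin *)

Section Branches.
Variables (R : realType) (f : R -> R * R).
Hypothesis f_curve : closed_regular_curve f.
Hypothesis f_generic : generic f.
Implicit Types (p q w : R * R) (g : R -> R * R) (c u v h s T : R).

Local Notation E := (parallel_lift f).
Let SG := parallel_lift_locally_graph f_curve f_generic.
Let Scl := parallel_lift_closed f_curve f_generic.
Let Sper := parallel_lift_period f_curve.

Lemma parallel_component p : E p -> exists g T,
  [/\ garc E g, g 0 = p, 0 < T, garc_has_period g T &
      connected_component (parallel_set f) (torus p) = range (torus \o g)].
Proof.
move=> Ep; have [g Ag g0] := garc_exists SG Scl Sper Ep.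
have [T T0 HT] := garc_period SG Scl Sper Ag.
exists g, T; split=> //.
by rewrite (parallel_setE f_curve f_generic) -g0; exact: component_range.
Qed.

Lemma parallel_set_torus p : parallel_set f (torus p) -> E p.
Proof. by rewrite (parallel_setE f_curve f_generic); exact: torus_mem. Qed.

Lemma branch_closed C : branch f C -> is_closed_curve C.
Proof.
case=> p0 Sp ->; have [p Ep <-] : (@torus R @` E) p0 by rewrite -parallel_setE.
have [g [T [Ag _ T0 HT ->]]] := parallel_component Ep.
by exists (fun u => g (T / period R * u)); exact: garc_closed_parameterization.
Qed.

Lemma parallel_lift_diag s : E (s, s) <-> inflexion f s.
Proof.
split=> [[[]//|[_ K0]]|/(inflexionP f_curve f_generic) K0]; last by right.
by apply/(inflexionP f_curve f_generic).
Qed.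

Lemma half_integer_multiple h T (k : int) : 2 * h = k%:~R * T ->
  exists q : int, h = q%:~R * T \/ h = T / 2 + q%:~R * T.
Proof.
move=> hk; exists (k %/ 2)%Z; move: hk; rewrite {1}(divz_eq k 2).
have : (k %% 2)%Z = 0 \/ (k %% 2)%Z = 1.
  by have := ltz_pmod k (isT : 0 < 2%Z); have := modz_ge0 k (isT : 2%Z != 0); lia.
move=> -[->|->] hk; [left|right].
  apply: (mulfI (_ : 2 != 0 :> R)); first by rewrite pnatr_eq0.
  by rewrite hk addr0 intrM; ring.
apply: (mulfI (_ : 2 != 0 :> R)); first by rewrite pnatr_eq0.
by rewrite hk intrD intrM; field.
Qed.

Section ThroughDiagonal.
Variables (g : R -> R * R) (T : R).
Hypothesis Ag : garc E g.
Hypothesis T0 : 0 < T.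
Hypothesis HT : garc_has_period g T.
Hypothesis g0 : circle (g 0).1 = circle (g 0).2.

Lemma torus_swap_garc h : torus (swap (g h)) = torus (g (- h)).
Proof.
have [w lw gw] := garc_diag_symmetric f_curve f_generic Ag g0.
by apply/esym/torus_eqP; exists w => //; have := gw (- h); rewrite add0r sub0r opprK.
Qed.

Lemma garc_diag h : circle (g h).1 = circle (g h).2 <->
  exists k : int, 2 * h = k%:~R * T.
Proof.
have -> : (circle (g h).1 = circle (g h).2) <-> torus (g h) = torus (swap (g h)).
  by rewrite /torus /=; split=> [->|[a b _ _]] //; congr pair.
by rewrite torus_swap_garc HT opprK mulr_natl mulr2n.
Qed.

Lemma garc_half_diag : circle (g (T / 2)).1 = circle (g (T / 2)).2.
Proof. by apply/garc_diag; exists 1; rewrite mul1r mulrC divfK// pnatr_eq0. Qed.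

Lemma garc_half_neq : torus (g (T / 2)) <> torus (g 0).
Proof.
move=> /HT[k]; rewrite subr0 => kE.
have : 1 = (2 * k)%:~R :> R.
  apply: (mulIf (lt0r_neq0 T0)); rewrite intrM -mulrA -kE mul1r mulrC divfK// pnatr_eq0.
by move=> /eqP; rewrite -[1]/(1%:~R) eqr_int => /eqP; lia.
Qed.

Lemma garc_center : center_of_symmetry 0 (branch_image f (range (torus \o g))).
Proof.
move=> _ [p [u _ /= up] <-]; rewrite scaler0 sub0r.
exists (swap p); last by rewrite /secant opprB.
exists (- u) => //=; rewrite -torus_swap_garc.
by move: up => [a b c d]; congr (pair (pair _ _) (pair _ _)).
Qed.

Lemma garc_twice : twice_inflexion_at_origin f (range (torus \o g)).
Proof.
pose c := T / period R; have P0 := period_gt0 R; have c0 : 0 < c by exact: divr_gt0.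
have Ec u : E (g (c * u)) by case: (Ag (c * u)).
have zero u : secant f (g (c * u)) = 0 <-> exists k : int, 2 * u = k%:~R * period R.
  rewrite (secant_eq0 f_curve f_generic (Ec u)) garc_diag.
  have -> : 2 * (c * u) = 2 * u / period R * T by rewrite /c; ring.
  split=> -[k kE]; exists k.
    apply: (mulIf (lt0r_neq0 (divr_gt0 T0 P0))); rewrite mulrA [LHS]mulrAC kE.
    by field; rewrite lt0r_neq0.
  by rewrite kE mulfK// lt0r_neq0.
exists (fun u => g (c * u)); split; first exact: garc_closed_parameterization.
(* A visit occurs when [2 * u] is a multiple of [period], so at the parameters 0 and [pi] of the
   circle, which are the times 0 and [T / 2] of the arc. *)
- rewrite (_ : circle @` _ = [set circle 0; circle pi]).
    apply/eq_cardSP; exists (circle 0); first by left.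
    rewrite (_ : _ `\ _ = [set circle pi]); first exact: card_set1.
    apply/seteqP; split=> [_ [[->|->]]// []//|_ ->]; split; first by right.
    by rewrite /circle cospi cos0 => -[/eqP]; rewrite eqNr oner_eq0.
  apply/seteqP; split=> [_ [u /zero[k /half_integer_multiple[q uE]] <-]|_ [] ->].
  + case: uE => ->; [left|right].
      by rewrite -[_ * _]add0r circleD_period.
    by rewrite circleD_period /period mulrAC divff ?mul1r ?pnatr_eq0.
  + by exists 0 => //; apply/zero; exists 0; rewrite mulr0 mul0r.
  + by exists pi => //; apply/zero; exists 1; rewrite mul1r.
- move=> u; rewrite (secant_eq0 f_curve f_generic (Ec u)) => cu.
  have [dE d0] := garc_diag_derive f_curve f_generic Ag cu.
  have cE v : c * v = 0 + c * (v - 0) by rewrite subr0 add0r.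
  have sc : (fun v => g (c * v)) = (fun v => g (0 + c * (v - 0))).
    by apply/funext => v; rewrite cE.
  have [_ [g1 g2] _] := Ag (c * u).
  have d1E : (fst \o (fun v => g (c * v)))^`()%classic u = derive1 (fst \o g) (c * u) * c.
    rewrite cE in g1 *; rewrite sc; exact: (derive1_affine (f := fst \o g)).
  have d2E : (snd \o (fun v => g (c * v)))^`()%classic u = derive1 (snd \o g) (c * u) * c.
    rewrite cE in g2 *; rewrite sc; exact: (derive1_affine (f := snd \o g)).
  apply: secant_inflexion => //.
  + by move=> v; exact: garc_scale_smooth Ag.
  + by rewrite d1E d2E dE mulNr.
  + by rewrite d1E mulf_neq0// lt0r_neq0.
Qed.

End ThroughDiagonal.

Lemma diagonal_component s : inflexion f s -> exists g T,
  [/\ garc E g, g 0 = (s, s), 0 < T, garc_has_period g T &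
      connected_component (parallel_set f) (circle s, circle s) = range (torus \o g)].
Proof. by move=> /parallel_lift_diag/parallel_component. Qed.

(** A visit of the origin is a diagonal point of the domain, hence an inflexion, and the branch is
    the component of that point. Conversely the component of an inflexion is the range of an arc
    that starts on the diagonal. *)
Lemma central_branchE :
  [set C | [/\ branch f C, center_of_symmetry 0 (branch_image f C) &
               twice_inflexion_at_origin f C]] =
  (fun a => connected_component (parallel_set f) (a, a)) @` (circle @` [set s | inflexion f s]).
Proof.
apply/seteqP; split=> [C [[p Sp CE] _ [sigma [[_ _ _ rE] card2 _]]]|_ [_ [s sI <-] <-]].
  have /eq_cardSP[_ [u /= u0 _] _] := card2.
  have Cu : C (torus (sigma u)) by rewrite -rE; exists u.
  have Eu : E (sigma u).
    by apply: parallel_set_torus; move: Cu; rewrite CE => /(@connected_component_sub _ _ _ _).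
  have /(secant_eq0 f_curve f_generic Eu) cu := u0.
  exists (circle (sigma u).1); last first.
    by move: Cu; rewrite CE /torus -cu => /same_connected_component.
  exists (sigma u).1 => //=; apply/parallel_lift_diag.
  by apply: parallel_lift_torus Eu => //; rewrite /torus /= cu.
have [g [T [Ag g0 T0 HT CE]]] := diagonal_component sI.
have cg : circle (g 0).1 = circle (g 0).2 by rewrite g0.
rewrite CE; split; [|exact: garc_center Ag cg|exact: garc_twice Ag T0 HT cg].
exists (torus (s, s)); last by rewrite -CE.
by rewrite (parallel_setE f_curve f_generic); exists (s, s) => //; exact/parallel_lift_diag.
Qed.

(** The partner of the inflexion at time 0 is the one at time [T / 2]: the arc is on the diagonal at
    the multiples of [T / 2] only, and these form two classes modulo [T]. *)
Lemma diagonal_component_pair a : (circle @` [set s | inflexion f s]) a ->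
  exists a', [/\ (circle @` [set s | inflexion f s]) a', a' <> a &
    forall b, (circle @` [set s | inflexion f s]) b ->
      connected_component (parallel_set f) (b, b) = connected_component (parallel_set f) (a, a) <->
      b = a \/ b = a'].
Proof.
move=> [s sI <-]; have [g [T [Ag g0 T0 HT CE]]] := diagonal_component sI.
have cg : circle (g 0).1 = circle (g 0).2 by rewrite g0.
have ch := garc_half_diag Ag HT cg.
have th : torus (g (T / 2)) = (circle (g (T / 2)).1, circle (g (T / 2)).1).
  by rewrite /torus -ch.
exists (circle (g (T / 2)).1); split.
- exists (g (T / 2)).1 => //=; apply/parallel_lift_diag.
  have [Eh _ _] := Ag (T / 2).
  by apply: (parallel_lift_torus f_curve _ Eh); rewrite th.
- move=> hE; apply: (garc_half_neq T0 HT); by rewrite th hE g0.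
move=> _ [s' sI' <-]; rewrite CE; split=> [bE|[->|->]].
- have : range (torus \o g) (torus (s', s')).
    rewrite -bE; apply: connected_component_refl.
    by rewrite (parallel_setE f_curve f_generic); exists (s', s') => //; exact/parallel_lift_diag.
  move=> [h _ /= hE].
  have chE : circle (g h).1 = circle s' := congr1 fst hE.
  have /(garc_diag Ag HT cg)[k /half_integer_multiple[q hq]] : circle (g h).1 = circle (g h).2.
    by rewrite chE; exact: esym (congr1 snd hE).
  rewrite -chE; case: hq => hq; [left|right].
    have : torus (g h) = torus (g 0) by apply/HT; exists q; rewrite subr0.
    by rewrite g0 => /(congr1 fst).
  have : torus (g h) = torus (g (T / 2)) by apply/HT; exists q; rewrite hq addrC addKr.
  by move=> /(congr1 fst).
- by rewrite CE.
- apply/esym; rewrite -CE; apply: same_connected_component.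
  by rewrite CE; exists (T / 2).
Qed.

End Branches.

Theorem theorem3p15 (R : realType) (f : R -> R * R) (n : nat)
  (f_curve : closed_regular_curve f)
  (f_generic : generic f)
  (f_inflexions : (circle @` [set s | inflexion f s] #= `I_(2 * n))%card) :
  (forall C, branch f C -> is_closed_curve C) /\
  ([set C | [/\ branch f C,
                center_of_symmetry 0 (branch_image f C) &
                twice_inflexion_at_origin f C]] #= `I_n)%card.

Proof.
split; first by move=> C; exact: branch_closed.
rewrite (central_branchE f_curve f_generic).
exact: card_two_to_one f_inflexions (diagonal_component_pair f_curve f_generic).
Qed.
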